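(* Let $d\ge2$, let $D\subset\mathbb{R}^d$ be a bounded open set with $C^\infty$ boundary and connected components $D_1,\dots,D_N$, let $D^+=\mathbb{R}^d\setminus\overline D$, and let $h$ be harmonic on $\mathbb{R}^d$. For $\gamma\ge0$ let $u^\gamma$ be the solution to $$ \begin{cases} \Delta u=0 & \text{in }\mathbb{R}^d\setminus\partial D,\\ u|_+-\gamma\,\partial_\nu u|_+=u|_-=\text{const.} & \text{on }\partial D_j,\ j=1,\dots,N,\\ \int_{\partial D_j}\partial_\nu u|_+\,d\sigma=0 & j=1,\dots,N,\\ u(x)-h(x)=O(|x|^{-d+1}) & \text{as }|x|\to\infty, \end{cases} $$ and let $v_l$ ($l=0,1,2,\dots$) be the harmonic functions in $D^+$ described in the context. Then for every $l$ and every multi-index $\alpha$ the derivative $\partial^\alpha v_l$ admits a continuous extension to $\overline{D^+}$. Furthermore, $u^\gamma\sim\sum_{l=0}^\infty\gamma^lv_l$ as $\gamma\to+0$ in the sense that $$\Big\|\partial^\alpha\Big(u^\gamma-\sum_{l=0}^K\gamma^lv_l\Big)\Big\|_{L^\infty(U\setminus\overline D)}=O(\gamma^{K+1})\quad(\gamma\to+0)$$ for all multi-indices $\alpha\in\mathbb{N}_0^d$, all $K\in\mathbb{N}_0$ and any open ball $U\subset\mathbb{R}^d$ including $\overline D$.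
   Context: $\nu$ is the unit normal on $\partial D$ outward with respect to $D$; $|_-$ and $|_+$ denote boundary traces from $D$ and $D^+$. The constants in the second condition are not prescribed and may depend on $j$. For each $\gamma\ge0$, $u^\gamma$ is the unique solution with $u^\gamma|_{U\setminus\overline D}\in H^{s+1/2,2}(U\setminus\overline D)$ for every $s\in(0,1)$ and every open ball $U\supset\overline D$. $H^{s,p}$ is the Bessel potential space and $B^{s,p}=B^{s,p}_p$ the Besov space (on bounded Lipschitz open sets: restrictions from $\mathbb{R}^d$ with quotient norm). The functions $v_l$: $v_0=u^0$, and $v_l$ ($l\ge0$) are the unique harmonic functions in $D^+$ such that for every integer $k\ge1$, $\theta\in(0,1]$, $s\in(k,k+\theta)$ and every open ball $U\supset\overline D$: for $0\le l\le k-1$, $v_l|_{U\setminus\overline D}\in B^{s+1/p-l,p}(U\setminus\overline D)$ for all $p\in[1,\infty]$ and $\in H^{s+1/p-l,p}(U\setminus\overline D)$ for all $p\in(1,\infty)$; and for $0\le K\le k-1$, $\|u^\gamma-\sum_{l=0}^K\gamma^lv_l\|_{H^{s+1/p-1-K,p}(U\setminus\overline D)}$ ($p\in(1,\infty)$) and $\|u^\gamma-\sum_{l=0}^K\gamma^lv_l\|_{B^{s+1/p-1-K,p}(U\setminus\overline D)}$ ($p\in(1,\infty]$) are $o(\gamma^K)$ as $\gamma\to+0$. *)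

(* Defs.v *)
From HB Require Import structures.
From mathcomp Require Import all_boot all_order all_algebra.
From mathcomp Require Import all_classical all_reals all_analysis.
Set Implicit Arguments. Unset Strict Implicit. Unset Printing Implicit Defensive.
Import Order.TTheory GRing.Theory Num.Theory.
Import numFieldNormedType.Exports.
Local Open Scope classical_set_scope.
Local Open Scope ring_scope.

(* R^n is 'rV[R]_n with the sigma-algebra generated by the coordinates, that is,
   the Borel sigma-algebra. *)
Definition measure_rV_display : measure_display -> measure_display.
Proof. exact. Qed.

Section measurable_rV.
Context {R : realType} {n : nat}.

Let coord : 'I_n -> 'rV[R]_n -> R := fun i x => x 0 i.

Let rV_set0 : g_sigma_preimage coord set0.
Proof. exact: sigma_algebra0. Qed.

Let rV_setC A : g_sigma_preimage coord A -> g_sigma_preimage coord (~` A).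
Proof. exact: sigma_algebraC. Qed.

Let rV_bigcup (F : (set 'rV[R]_n)^nat) :
  (forall i, g_sigma_preimage coord (F i)) ->
  g_sigma_preimage coord (\bigcup_i (F i)).
Proof. exact: sigma_algebra_bigcup. Qed.

HB.instance Definition _ := @isMeasurable.Build
  (measure_rV_display (ocitv_display R)) 'rV[R]_n (g_sigma_preimage coord)
  rV_set0 rV_setC rV_bigcup.
End measurable_rV.

Section rV_cons.
Context {R : realType}.

Definition rV_cons n (t : R) (y : 'rV[R]_n) : 'rV[R]_n.+1 :=
  \row_i oapp (fun j => y 0 j) t (unlift 0 i).

Lemma measurable_coord n (i : 'I_n) :
  measurable_fun setT (fun x : 'rV[R]_n => x 0 i).
Proof.
move=> _ Y mY; rewrite setTI; apply: sub_sigma_algebra => /=.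
rewrite -bigcup_seq/=; exists i => /=; first by rewrite mem_index_enum.
by exists Y => //; rewrite setTI.
Qed.

Lemma measurable_fun_rVP d (T : measurableType d) n (f : T -> 'rV[R]_n) :
  (forall i, measurable_fun setT (fun x => f x 0 i)) -> measurable_fun setT f.
Proof.
move=> mf _ Y mY; rewrite setTI.
suff : (measurable : set (set 'rV[R]_n)) `<=` [set Z | measurable (f @^-1` Z)].
  exact.
apply: smallest_sub => /=.
  split=> /= [|A mA|F mF]; first by rewrite preimage_set0.
  - by rewrite setTD preimage_setC; exact: measurableC.
  - by rewrite preimage_bigcup; exact: bigcup_measurable.
rewrite -bigcup_seq => Z [i _] [B mB <-]/=; rewrite setTI.
by rewrite -[X in measurable X]setTI; exact: mf.
Qed.

Lemma measurable_rV_cons n :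
  measurable_fun setT (fun z : R * 'rV[R]_n => rV_cons z.1 z.2).
Proof.
apply: measurable_fun_rVP => i.
case: (unliftP 0 i) => [j|] ->.
  rewrite (_ : (fun _ => _) = (fun x : 'rV[R]_n => x 0 j) \o snd).
    by apply: measurableT_comp; [exact: measurable_coord|exact: measurable_snd].
  by apply/funext => z /=; rewrite mxE liftK.
rewrite (_ : (fun _ => _) = fst); first exact: measurable_fst.
by apply/funext => z /=; rewrite mxE unlift_none.
Qed.

Lemma measurable_rV_behead n :
  measurable_fun setT (fun x : 'rV[R]_n.+1 => \row_j x 0 (lift 0 j)).
Proof.
apply: measurable_fun_rVP => i.
rewrite (_ : (fun _ => _) = (fun x : 'rV[R]_n.+1 => x 0 (lift 0 i))).
  exact: measurable_coord.
by apply/funext => x; rewrite mxE.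
Qed.

End rV_cons.

Lemma open_measurable_rV (R : realType) n (U : set 'rV[R]_n.+1) :
  open U -> measurable U.
Proof.
move=> oU.
pose B (z : 'rV[rat]_n.+1 * nat) : set 'rV[R]_n.+1 :=
  [set x | forall i, `|ratr (z.1 0 i) - x 0 i| < z.2.+1%:R^-1].
have mB z : measurable (B z).
  rewrite (_ : B z = \big[setI/setT]_(i < n.+1)
      ((fun x : 'rV[R]_n.+1 => x 0 i) @^-1`
        ball (ratr (z.1 0 i) : R) z.2.+1%:R^-1)).
    apply: bigsetI_measurable => i _; rewrite -[X in measurable X]setTI.
    apply: measurable_coord => //; apply: measurable_realfun.open_measurable.
    exact: ball_open.
  rewrite -bigcap_seq; apply/seteqP; split => [x Bx i _|x Bx i].
    exact: Bx.
  by apply: (Bx i); rewrite /= mem_index_enum.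
pose F k := if unpickle k is Some z then
  (if `[< B z `<=` U >] then B z else set0) else set0.
suff -> : U = \bigcup_k F k.
  apply: bigcup_measurable => k _; rewrite /F.
  by case: unpickle => // z; case: ifP.
apply/seteqP; split => [x Ux|x [k _]]; last first.
  by rewrite /F; case: unpickle => // z; case: asboolP => // + Bx; exact.
have /nbhs_ballP[e /= e0 xeU] : nbhs x U by exact: open_nbhs_nbhs.
have [k ke] : exists k : nat, k.+1%:R^-1 < e / 2.
  exists (Num.truncn (e / 2)^-1); rewrite invf_plt ?posrE ?divr_gt0//.
  by rewrite truncnS_gt.
have k0 : 0 < k.+1%:R^-1 :> R by rewrite invr_gt0.
have qP i : {q : rat | `|ratr q - x 0 i| < k.+1%:R^-1}.
  apply: cid.
  have /rat_in_itvoo[q] : x 0 i - k.+1%:R^-1 < x 0 i + k.+1%:R^-1.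
    by rewrite ltrBlDr -addrA ltrDl addr_gt0.
  rewrite inE/= => /itvP qi; exists q.
  by rewrite ltr_distl !qi.
pose z : 'rV[rat]_n.+1 * nat := (\row_i sval (qP i), k).
have Bx : B z x by move=> i; rewrite /= mxE; exact: svalP (qP i).
exists (pickle z) => //; rewrite /F pickleK; case: asboolP => // BU.
exfalso; apply: BU => y By; apply: xeU; split=> // i j.
rewrite !ord1.
have : `|x 0 j - y 0 j| < e; last by [].
have := By j; have := Bx j; rewrite distrC /= => xz zy.
rewrite -(subrKA (ratr ((\row_i sval (qP i)) 0 j))).
rewrite (le_lt_trans (ler_normD _ _))// [ltRHS]splitr.
by rewrite ltrD// (lt_trans _ ke).
Qed.

(* Lebesgue measure on R^n as an iterated integral. *)
Fixpoint lebesgue_rV {R : realType} n : set 'rV[R]_n -> \bar R :=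
  match n with
  | 0 => fun A => \d_(0 : 'rV[R]_0) A
  | m.+1 => fun A => (\int[lebesgue_measure]_t lebesgue_rV [set y | A (rV_cons t y)])%E
  end.

Section lebesgue_rV_measure.
Context {R : realType}.

Lemma lebesgue_rV_sigma_finite_measure n :
  exists mu : {sigma_finite_measure set 'rV[R]_n -> \bar R},
    @lebesgue_rV R n = mu.
Proof.
elim: n => [|n [mu leb_mu]].
  by exists (\d_(0 : 'rV[R]_0) : {sigma_finite_measure set _ -> \bar R}).
pose lm : {sigma_finite_measure set (measurableTypeR R) -> \bar R} :=
  @lebesgue_measure R.
pose c (z : measurableTypeR R * 'rV[R]_n) : 'rV[R]_n.+1 := rV_cons z.1 z.2.
have mc : measurable_fun setT c by exact: measurable_rV_cons.
pose P : {measure set (measurableTypeR R * 'rV[R]_n)%type -> \bar R} :=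
  (lm \x mu)%E.
pose nu (A : set 'rV[R]_n.+1) := P (c @^-1` A).
have lebE : @lebesgue_rV R n.+1 = nu.
  apply/funext => A; rewrite /nu /product_measure1 /=.
  apply: eq_integral => t _ /=; rewrite leb_mu; congr (mu _).
  by apply/seteqP; split => y /=; rewrite /xsection/= inE.
have nu_sf : sigma_finite setT nu.
  have [F FT Foo] : sigma_finite setT P.
    have /sigma_finiteP[F [TF ndF Foo]] := sigma_finiteT lm.
    have /sigma_finiteP[G [TG ndG Goo]] := sigma_finiteT mu.
    exists (fun n => F n `*` G n).
      rewrite -setXTT TF TG predeqE => -[x y]; split.
        move=> [/= [k _ Fkx] [m _ Gmy]]; exists (maxn k m) => //; split.
        - by move: x Fkx; exact/subsetPset/ndF/leq_maxl.
        - by move: y Gmy; exact/subsetPset/ndG/leq_maxr.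
      by move=> [k _ []/= ? ?]; split; exists k.
    move=> k; have [? ?] := Foo k; have [? ?] := Goo k.
    split; first exact: measurableX.
    by rewrite /P /= product_measure1E// lte_mul_pinfty// ge0_fin_numE.
  pose g (x : 'rV[R]_n.+1) : measurableTypeR R * 'rV[R]_n :=
    (x 0 0, \row_j x 0 (lift 0 j)).
  have mg : measurable_fun setT g.
    apply/measurable_fun_pairP; split.
      exact: (@measurable_coord R n.+1 0).
    exact: measurable_rV_behead.
  have gK z : g (c z) = z.
    case: z => t y; rewrite /g /c /=; congr pair.
      by rewrite mxE unlift_none.
    by apply/rowP => j; rewrite !mxE liftK.
  exists (fun i => g @^-1` F i).
    by rewrite -preimage_bigcup -FT preimage_setT.
  move=> i; split.
    by rewrite -[X in measurable X]setTI; apply: mg => //; exact: (Foo i).1.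
  rewrite /nu -comp_preimage (_ : g \o c = id) ?preimage_id.
    exact: (Foo i).2.
  by apply/funext => z /=; exact: gK.
have nu0 : nu set0 = 0%E by rewrite /nu preimage_set0 measure0.
have nu_ge0 A : (0 <= nu A)%E by exact: measure_ge0.
have nu_sa : semi_sigma_additive nu.
  have mpre A : measurable A -> measurable (c @^-1` A).
    by move=> mA; rewrite -[X in measurable X]setTI; exact: mc.
  move=> F mF tF mUF; rewrite /nu preimage_bigcup.
  apply: measure_semi_sigma_additive.
  - by move=> k; exact: mpre.
  - apply/trivIsetP => /= i j _ _ ij; rewrite -preimage_setI.
    by move/trivIsetP : tF => /(_ _ _ _ _ ij) ->//; rewrite preimage_set0.
  - by rewrite -preimage_bigcup; exact: mpre.
pose nu_measure := isMeasure.Build _ _ _ nu nu0 nu_ge0 nu_sa.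
pose nu1 : {measure set 'rV[R]_n.+1 -> \bar R} := HB.pack nu nu_measure.
pose nu_sigma_finite := Measure_isSigmaFinite.Build _ _ _ nu1 nu_sf.
pose nu' : {sigma_finite_measure set 'rV[R]_n.+1 -> \bar R} :=
  HB.pack nu nu_measure nu_sigma_finite.
by exists nu'; rewrite lebE.
Qed.

Let lebesgue_rV0 n : @lebesgue_rV R n set0 = 0%E.
Proof.
by have [mu ->] := lebesgue_rV_sigma_finite_measure n; rewrite measure0.
Qed.

Let lebesgue_rV_ge0 n (A : set 'rV[R]_n) : (0 <= lebesgue_rV A)%E.
Proof. by have [mu ->] := lebesgue_rV_sigma_finite_measure n. Qed.

Let lebesgue_rV_sigma_additive n : semi_sigma_additive (@lebesgue_rV R n).
Proof.
have [mu ->] := lebesgue_rV_sigma_finite_measure n.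
exact: measure_semi_sigma_additive.
Qed.

HB.instance Definition _ n := isMeasure.Build _ _ _ (@lebesgue_rV R n)
  (lebesgue_rV0 n) (@lebesgue_rV_ge0 n) (@lebesgue_rV_sigma_additive n).

Let lebesgue_rVT n : sigma_finite setT (@lebesgue_rV R n).
Proof.
have [mu ->] := lebesgue_rV_sigma_finite_measure n.
exact: sigma_finiteT.
Qed.

HB.instance Definition _ n := @Measure_isSigmaFinite.Build _ _ _
  (@lebesgue_rV R n) (lebesgue_rVT n).

End lebesgue_rV_measure.

Section euclidean.
Context {R : realType}.

(* The library's norm and balls on 'rV[R]_n are those of the sup norm. *)
Definition enorm n (x : 'rV[R]_n) : R := Num.sqrt (\sum_i x 0 i ^+ 2).

Definition eball n (c : 'rV[R]_n) (r : R) : set 'rV[R]_n :=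
  [set x | enorm (x - c) < r].

Definition open_ball n (U : set 'rV[R]_n) : Prop :=
  exists c r, 0 < r /\ U = eball c r.

End euclidean.

Section derivatives.
Context {R : realType} {n : nat}.
Local Notation E := 'rV[R]_n.+1.
Implicit Types (f : E -> R) (A : set E) (w : seq 'I_n.+1).

Definition partial (i : 'I_n.+1) f : E -> R := 'D_(delta_mx 0 i) f.

Definition partials w f : E -> R := foldr partial f w.

Definition multi_partial (alpha : 'I_n.+1 -> nat) f : E -> R :=
  partials (flatten [seq nseq (alpha i) i | i <- enum 'I_n.+1]) f.

Definition smooth_on A f : Prop :=
  forall w x, A x -> differentiable (partials w f) x.

(* Of class C^2 with vanishing Laplacian; A is meant to be open. *)
Definition harmonic_on A f : Prop := forall x, A x ->
  [/\ forall w, (size w <= 1)%N -> differentiable (partials w f) x,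
      forall w, size w = 2%N -> {for x, continuous (partials w f)}
    & \sum_i partial i (partial i f) x = 0].

Definition test_function f : Prop :=
  smooth_on setT f /\ exists r, forall x, r < enorm x -> f x = 0.

End derivatives.

Section domains.
Context {R : realType} {n : nat}.
Local Notation E := 'rV[R]_n.+1.
Implicit Types (D : set E).

Definition boundary D : set E := closure D `\` interior D.

Definition exterior D : set E := ~` closure D.

Definition smooth_boundary D : Prop := forall x, boundary D x ->
  exists (V : set E) (rho : E -> R),
    [/\ open V, V x, smooth_on V rho, exists i, partial i rho x != 0
      & forall y, V y -> (D y <-> rho y < 0)].

Definition is_components N D (Dj : 'I_N -> set E) : Prop :=
  [/\ forall j, exists2 x, D x & Dj j = connected_component D x,
      injective Dj & D = \bigcup_(j in setT) Dj j].

End domains.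

Section surface_measure.
Context {R : realType} {n : nat}.
Local Notation E := 'rV[R]_n.+1.

Definition diam (A : set E) : R :=
  fine (ereal_sup [set (enorm (z.1 - z.2))%:E | z in A `*` A]).

Definition delta_cover (delta : R) (A : set E) (F : (set E)^nat) : Prop :=
  A `<=` \bigcup_k F k /\
  forall k x y, F k x -> F k y -> enorm (x - y) <= delta.

(* The n-dimensional Hausdorff (outer) measure on R^(n+1), n > 0, normalised by
   the volume of the unit ball of R^n; on Borel subsets of a smooth hypersurface
   it is the surface measure. *)
Definition surface_measure (A : set E) : \bar R :=
  let c := fine (lebesgue_rV [set y : 'rV[R]_n | enorm y <= 1]) in
  ereal_sup [set
    ereal_inf [set (\sum_(k <oo) (c * (diam (F k) / 2) ^+ n)%:E)%E
              | F in delta_cover delta A]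
    | delta in [set delta : R | 0 < delta]].

End surface_measure.

Section function_spaces.
Context {R : realType} {n : nat}.
Local Notation E := 'rV[R]_n.+1.
Local Notation leb := (@lebesgue_rV R n.+1).
Implicit Types (f g F : E -> R) (A : set E) (p : \bar R) (s : R).

Definition Lp_norm p f : \bar R := Lnorm leb p (EFin \o f).

Definition Linfty_norm A f : \bar R := Lp_norm +oo%E (fun x => \1_A x * f x).

Definition gamma_fun (a : R) : R :=
  Rintegral lebesgue_measure `]0, +oo[ (fun t => t `^ (a - 1) * expR (- t)).

(* The kernel of (1 - Delta)^(-s/2), s > 0, obtained by subordination
   Gamma(s/2)^-1 int_0^oo t^(s/2 - 1) e^(-t) e^(t Delta) dt from the heat kernel
   (4 pi t)^(-d/2) e^(-|x|^2 / 4t), d = n + 1. *)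
Definition bessel_kernel s (x : E) : R :=
  (gamma_fun (s / 2))^-1 *
  Rintegral lebesgue_measure `]0, +oo[ (fun t =>
    t `^ (s / 2 - 1) * expR (- t) *
    ((4 * pi * t) `^ (- (n.+1%:R / 2)) * expR (- (enorm x ^+ 2 / (4 * t))))).

Definition convolution g f (x : E) : R :=
  Rintegral leb setT (fun y => g (x - y) * f y).

(* H^{s,p}(R^d), s > 0, is the image of L^p under G_s * _ ; the norm of F is
   that of its preimage, and is +oo off the space. *)
Definition bessel_norm_full s p F : \bar R :=
  ereal_inf [set Lp_norm p g | g in [set g | measurable_fun setT g /\
    {ae leb, forall x, F x = convolution (bessel_kernel s) g x}]].

Definition difference (m : nat) (y : E) F (x : E) : R :=
  \sum_(i < m.+1) (-1) ^+ (m - i) * 'C(m, i)%:R * F (x + i%:R *: y).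

(* For 1 <= p <= oo and s > 0: the norm of B^{s,p}_p(R^d) given by differences
   of order m, the least integer greater than s:
   |F|_p + (int (|y|^-s |Delta_y^m F|_p)^p |y|^-d dy)^(1/p). *)
Definition besov_norm_full s p F : \bar R :=
  let m := (Num.truncn s).+1 in
  (Lp_norm p F +
   match p with
   | r%:E => (\int[leb]_y ((Lp_norm p (difference m y F)) `^ r *
                ((enorm y) `^ (- (s * r + n.+1%:R)))%:E)) `^ r^-1
   | _ => ereal_sup [set (Lp_norm p (difference m y F) *
                ((enorm y) `^ (- s))%:E) | y in [set y : E | (y != 0)%R]]
   end)%E.

(* Quotient norms on A: +oo means that f is not in the space. *)
Definition bessel_norm A s p f : \bar R :=
  ereal_inf [set bessel_norm_full s p F | F in
    [set F | {ae leb, forall x, A x -> F x = f x}]].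

Definition besov_norm A s p f : \bar R :=
  ereal_inf [set besov_norm_full s p F | F in [set F | measurable_fun setT F /\
    {ae leb, forall x, A x -> F x = f x}]].

End function_spaces.

Section boundary_value_problem.
Context {R : realType} {n : nat}.
Local Notation E := 'rV[R]_n.+1.
Local Notation leb := (@lebesgue_rV R n.+1).
Local Notation sigma := (@surface_measure R n).
Implicit Types (A G D U : set E) (u g h phi : E -> R).

(* g in L^2(G) is the trace on G, a closed part of the boundary of A, of u in
   H^{s+1/2,2}(A), 0 < s < 1: the trace operator is the continuous extension of
   the restriction of test functions. *)
Definition is_trace s A G u g : Prop :=
  measurable_fun G g /\
  exists w : nat -> E -> R,
    [/\ forall k, test_function (w k),
        bessel_norm A (s + 2^-1) 2%:E (fun x => u x - w k x)
          @[k --> \oo] --> 0%E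
      & (\int[sigma]_(x in G) ((w k x - g x) ^+ 2)%:E)%E
          @[k --> \oo] --> 0%E].

(* The pairing over the boundary of D of d_nu u|_+ with phi, where nu is the
   unit normal outward with respect to D, for u harmonic in the exterior of D
   and in H^1 near D: by Green's formula it is minus the Dirichlet form. For u
   in H^{s+1/2,2}, s < 1, this is how the normal derivative is defined. *)
Definition dnu_plus D u phi : R :=
  - Rintegral leb (exterior D)
      (fun x => \sum_i partial i u x * partial i phi x).

Record is_solution N D (Dj : 'I_N -> set E) h (gamma : R) u : Prop := {
  solution_harmonic : harmonic_on (~` boundary D) u;
  (* H^{s+1/2,2} regularity outside D, and the first boundary condition, with
     constants c j, where g is u|_+; the equation u|_+ - gamma d_nu u|_+ = c j
     holds in the sense of distributions on the boundary. *)
  solution_transmission : exists (c : 'I_N -> R) (g : E -> R),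
    [/\ forall s U, 0 < s < 1 -> open_ball U -> closure D `<=` U ->
          (bessel_norm (U `\` closure D) (s + 2^-1) 2%:E u < +oo)%E /\
          is_trace s (U `\` closure D) (boundary D) u g,
        forall phi, test_function phi ->
          (\sum_j \int[sigma]_(x in boundary (Dj j))
             ((g x - c j) * phi x)%:E)%E = (gamma * dnu_plus D u phi)%:E
      & forall j, exists2 s, 0 < s < 1 &
          is_trace s (Dj j) (boundary (Dj j)) u (cst (c j))];
  (* The flux is the pairing with the indicator function of the j-th part of
     the boundary; the pairing depends on phi only through its values there. *)
  solution_flux : forall j phi, test_function phi ->
    (forall x, boundary (Dj j) x -> phi x = 1) ->
    (forall i x, i != j -> boundary (Dj i) x -> phi x = 0) ->
    dnu_plus D u phi = 0;
  solution_decay : exists C r, forall x, r <= enorm x ->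
    ~ boundary D x -> `|u x - h x| <= C * enorm x ^- n
}.

(* f gamma = o(gamma ^ K) as gamma -> 0+ *)
Definition is_little_o (f : R -> \bar R) (K : nat) : Prop :=
  forall eps, 0 < eps ->
    \forall gamma \near 0^'+, (f gamma <= (eps * gamma ^+ K)%:E)%E.

(* f gamma = O(gamma ^ K) as gamma -> 0+ *)
Definition is_big_O (f : R -> \bar R) (K : nat) : Prop :=
  exists C, \forall gamma \near 0^'+, (f gamma <= (C * gamma ^+ K)%:E)%E.

Definition remainder (u : R -> E -> R) (v : nat -> E -> R) K gamma (x : E) : R :=
  u gamma x - \sum_(l < K.+1) gamma ^+ l * v l x.

Definition recip (p : \bar R) : R := if p is r%:E then r^-1 else 0.

Record is_expansion D (u : R -> E -> R) (v : nat -> E -> R) : Prop := {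
  expansion_v0 : forall x, exterior D x -> v 0%N x = u 0 x;
  expansion_harmonic : forall l, harmonic_on (exterior D) (v l);
  expansion_regular : forall (k l : nat) (theta s : R) U,
    (1 <= k)%N -> 0 < theta <= 1 -> k%:R < s < k%:R + theta ->
    open_ball U -> closure D `<=` U -> (l <= k.-1)%N ->
    (forall p : \bar R, (1 <= p)%E ->
      (besov_norm (U `\` closure D) (s + recip p - l%:R) p (v l) < +oo)%E) /\
    (forall p : R, 1 < p ->
      (bessel_norm (U `\` closure D) (s + p^-1 - l%:R) p%:E (v l) < +oo)%E);
  expansion_remainder : forall (k K : nat) (theta s : R) U,
    (1 <= k)%N -> 0 < theta <= 1 -> k%:R < s < k%:R + theta ->
    open_ball U -> closure D `<=` U -> (K <= k.-1)%N ->
    (forall p : R, 1 < p ->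
      is_little_o (fun gamma => bessel_norm (U `\` closure D)
        (s + p^-1 - 1 - K%:R) p%:E (remainder u v K gamma)) K) /\
    (forall p : \bar R, (1 < p)%E ->
      is_little_o (fun gamma => besov_norm (U `\` closure D)
        (s + recip p - 1 - K%:R) p (remainder u v K gamma)) K)
}.

End boundary_value_problem.

(* Main.v *)
Require Import Defs.
From HB Require Import structures.
From mathcomp Require Import all_boot all_order all_algebra.
From mathcomp Require Import all_classical all_reals all_analysis.
From mathcomp Require Import measurable_realfun ess_sup_inf hoelder.
From mathcomp Require Import ring lra.
Set Implicit Arguments. Unset Strict Implicit. Unset Printing Implicit Defensive.
Import Order.TTheory GRing.Theory Num.Theory.
Import numFieldNormedType.Exports.
Local Open Scope classical_set_scope.
Local Open Scope ring_scope.

(* Only the exponent p = +oo is needed: a function with finite B^{s,oo} norm on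
   R^d, s large, has bounded derivatives of high order, and the remainder of
   order K is the remainder of order K+1, which is o(gamma^(K+1)), plus
   gamma^(K+1) v_(K+1).

   The embedding is proved with finite differences. For almost every x0 the
   Besov bounds on the differences of the extension F, which for each shift hold
   almost everywhere, hold at all points of x0 + Q^d for all rational shifts.
   Marchaud's inequality makes F uniformly continuous on this coset, hence gives
   a function G on R^d satisfying the same bounds everywhere and equal to f on
   the open set where F = f almost everywhere and f is continuous. Second
   differences of G being O(|y|^a) for some a > 1, its dyadic difference
   quotients converge geometrically to a derivative, whose differences are
   controlled with a third of the exponent; as s is arbitrary, this loss is
   harmless. *)

(** * Finite differences *)

Section finite_differences.
Context {R : realType} {V : zmodType}.
Implicit Types (F G : V -> R) (x y : V) (M K : R).

Definition fdiff y F x : R := F (x + y) - F x.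
Definition fsum y F x : R := F (x + y) + F x.

Lemma fsum_fdiffC y F : fsum y (fdiff y F) = fdiff y (fsum y F).
Proof. by apply/funext => x; rewrite /fsum /fdiff; ring. Qed.

Lemma fdiff_double y F : fdiff (y + y) F = fsum y (fdiff y F).
Proof. by apply/funext => x; rewrite /fsum /fdiff addrA; ring. Qed.

(** With [T] the translation by [y], this is [(T^2 - 1)^j = (T + 1)^j (T - 1)^j]. *)
Lemma iter_fdiff_double y F j :
  iter j (fdiff (y + y)) F = iter j (fsum y) (iter j (fdiff y) F).
Proof.
elim: j => // j IH; rewrite iterS IH fdiff_double iterS; congr (fsum y _).
rewrite [in RHS]iterS; elim: j (iter j (fdiff y) F) {IH} => [//|j IH] G.
by rewrite !iterS -IH fsum_fdiffC.
Qed.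

(** [(T + 1)^j - 2^j] is a multiple of [T - 1], so the error is at most [j 2^(j-1) M]; the factor 2
    on both sides avoids the exponent [j - 1]. *)
Lemma iter_fsum_approx y G M j : (forall x, `|fdiff y G x| <= M) ->
  forall x, `|2 * (iter j (fsum y) G x - 2 ^+ j * G x)| <= 2 ^+ j * j%:R * M.
Proof.
move=> GM; elim: j => [|j IH] x.
  by rewrite /= expr0 mul1r subrr !mulr0 normr0 mul0r.
rewrite (_ : 2 * _ = 2 * (iter j (fsum y) G (x + y) - 2 ^+ j * G (x + y)) +
    2 * (iter j (fsum y) G x - 2 ^+ j * G x) + 2 ^+ j.+1 * fdiff y G x).
  rewrite (le_trans (ler_normD _ _))//.
  rewrite (le_trans (lerD (ler_normD _ _) (lexx _)))//.
  rewrite [`|2 ^+ _ * _|]normrM [`|2 ^+ _|]ger0_norm//.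
  have := lerD (lerD (IH (x + y)) (IH x))
    (ler_wpM2l (exprn_ge0 j.+1 (ler0n R 2)) (GM x)).
  move=> /le_trans; apply; rewrite exprS -natr1; lra.
by rewrite iterS exprS /fsum /fdiff; ring.
Qed.

Lemma iter_fdiff_bound y F M j : (forall x, `|F x| <= M) ->
  forall x, `|iter j (fdiff y) F x| <= 2 ^+ j * M.
Proof.
move=> FM; elim: j => [|j IH] x; first by rewrite expr0 mul1r FM.
rewrite iterS /fdiff (le_trans (ler_normB _ _))//.
by have := lerD (IH (x + y)) (IH x); rewrite exprS; lra.
Qed.

(** [B p y] stands for [|y| <= 2^-p]. It is abstract because the shifts are vectors of a normed
    space in one use and rational vectors, measured by their real images, in another. *)
Variable B : nat -> V -> Prop.
Hypothesis B_double : forall p y, B p.+1 y -> B p (y + y).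

(** Marchaud's inequality on dyadic scales. By the factorisation above, [2^j D_y^j F] is
    [D_(2y)^j F] up to differences of order [j + 1], so a bound at scale [p] gives one at scale
    [p + 1]. *)
Lemma marchaud_step (F : V -> R) (j : nat) (rho M K : R) :
  0 < rho -> (2 ^+ j)^-1 <= 3 / 4 * rho -> (forall x, `|F x| <= M) ->
  (forall p y x, B p y -> `|iter j.+1 (fdiff y) F x| <= K * rho ^+ p) ->
  forall p y x, B p y ->
    `|iter j (fdiff y) F x| <= (2 ^+ j * M + 2 * j%:R * `|K|) * rho ^+ p.
Proof.
move=> rho0 jrho FM FK.
have M0 : 0 <= M by exact: le_trans (FM 0).
set A := 2 ^+ j * M + 2 * j%:R * `|K|.
have A0 : 0 <= A by rewrite /A addr_ge0 ?mulr_ge0.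
have AM : 2 ^+ j * M <= A by rewrite /A lerDl ?mulr_ge0.
elim=> [|p IH] y x Bpy.
  by rewrite expr0 mulr1 (le_trans _ AM)//; exact: iter_fdiff_bound.
have := IH _ x (B_double Bpy); rewrite iter_fdiff_double => IHx.
have KK q : K * rho ^+ q <= `|K| * rho ^+ q.
  by rewrite ler_wpM2r ?exprn_ge0 ?(ltW rho0)// ler_norm.
have := iter_fsum_approx j (fun x => le_trans (FK _ _ x Bpy) (KK _)) x.
set u := iter j (fsum y) _ x in IHx *; set w := iter j _ F x.
have p2 : 0 < 2 ^+ j :> R by rewrite exprn_gt0.
rewrite normrM (ger0_norm (ler0n _ 2)) => uw.
have Tw : 2 ^+ j * `|w| <=
    A * rho ^+ p + 2 ^+ j * (j%:R / 2 * (`|K| * rho ^+ p.+1)).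
  rewrite -[X in X * `|w|]gtr0_norm// -normrM -[_ * w](subKr u).
  by rewrite (le_trans (ler_normB _ _))//; lra.
have : `|w| <= (2 ^+ j)^-1 * (A * rho ^+ p) + j%:R / 2 * (`|K| * rho ^+ p.+1).
  by rewrite -(ler_pM2l p2) (le_trans Tw)// mulrDr
    [X in _ <= X + _]mulrA mulfV ?gt_eqF// mul1r.
move=> /le_trans; apply.
(* Of [A * rho ^+ p.+1], the previous scale uses 3/4, by [jrho], and the differences of order
   [j + 1] use 1/4, by the term [2 j |K|] of [A]. *)
have Ar : 0 <= A * rho ^+ p by rewrite mulr_ge0 ?exprn_ge0// ltW.
have := ler_wpM2r Ar jrho.
have : 2 * j%:R * `|K| * rho ^+ p.+1 <= A * rho ^+ p.+1.
  by rewrite ler_wpM2r ?exprn_ge0 ?(ltW rho0)// /A lerDr mulr_ge0.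
by rewrite exprS; lra.
Qed.

End finite_differences.

(* The rate 1/3 lies above 1/4, where the recursion from order 3 to order 2 is
   critical, and below 1/2, which makes 2^i |D_(2^-i y)^2 F| summable. *)
Lemma marchaud2 (R : realType) (m : nat) : (2 <= m)%N ->
  exists2 C : R, 0 <= C & forall (V : zmodType) (B : nat -> V -> Prop),
    (forall p y, B p.+1 y -> B p (y + y)) ->
    forall (F : V -> R) (M : R), (forall x, `|F x| <= M) ->
    (forall p y x, B p y -> `|iter m (fdiff y) F x| <= M * 3^-1 ^+ p) ->
    forall p y x, B p y -> `|iter 2 (fdiff y) F x| <= C * M * 3^-1 ^+ p.
Proof.
case: m => [//|[//|m]] _.
(* The sup bound [M] and the difference bound [K] are separated for the induction: lowering the
   order changes [K] only. *)
suff [C C0 CP] : exists2 C : R, 0 <= C & forall (V : zmodType)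
    (B : nat -> V -> Prop), (forall p y, B p.+1 y -> B p (y + y)) ->
    forall (F : V -> R) (M : R), (forall x, `|F x| <= M) ->
    forall K : R, 0 <= K ->
    (forall p y x, B p y -> `|iter m.+2 (fdiff y) F x| <= K * 3^-1 ^+ p) ->
    forall p y x, B p y -> `|iter 2 (fdiff y) F x| <= C * (M + K) * 3^-1 ^+ p.
  exists (2 * C) => [|V B B2 F M FM FK p y x /CP]; first by rewrite mulr_ge0.
  move=> /(_ B2 F M FM M (le_trans _ (FM 0)) FK x).
  by rewrite (_ : C * (M + M) = 2 * C * M) => [->|]; last by ring.
elim: m => [|m [C C0 IH]].
  exists 1 => // V B B2 F M FM K K0 FK p y x Bpy.
  rewrite (le_trans (FK p y x Bpy))// ler_wpM2r ?exprn_ge0// mul1r lerDr.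
  exact: le_trans (FM 0).
exists (C * (1 + (2 ^+ m.+2 + 2 * m.+2%:R))).
  by rewrite mulr_ge0// !addr_ge0// mulr_ge0.
move=> V B B2 F M FM K K0 FK p y x Bpy.
have M0 : 0 <= M by exact: le_trans (FM 0).
(* This is [2^-j <= 3/4 * 1/3] for [j = m + 2], an equality in the last descent, from order 3 to
   order 2. *)
have m4 : (2 ^+ m.+2)^-1 <= 3 / 4 * 3^-1 :> R.
  have : 1 <= 2 ^+ m :> R by rewrite exprn_ege1// ler1n.
  rewrite !exprS mulrA; set t := 2 ^+ m => t1.
  by rewrite invf_ple ?posrE; lra.
have := marchaud_step B2 _ m4 FM FK.
rewrite (ger0_norm K0) => /(_ ltac:(lra)) H.
set K' := 2 ^+ m.+2 * M + 2 * m.+2%:R * K in H.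
have a0 : 0 <= 2 ^+ m.+2 :> R by rewrite exprn_ge0.
have b0 : 0 <= 2 * m.+2%:R :> R by rewrite mulr_ge0.
have K'0 : 0 <= K'.
  by rewrite /K' addr_ge0//; [exact: mulr_ge0 a0 M0|exact: mulr_ge0 b0 K0].
rewrite (le_trans (IH V B B2 F M FM K' K'0 H p y x Bpy))//.
rewrite ler_wpM2r ?exprn_ge0// -mulrA ler_wpM2l//.
rewrite /K'; move: a0 b0; set a := 2 ^+ m.+2; set b := 2 * m.+2%:R => a0 b0.
have := mulr_ge0 a0 K0; have := mulr_ge0 b0 M0. lra.
Qed.

(** * Dyadic directional derivatives *)

(** The steps are bounded by [e i - e i.+1] with [e i = c * r ^+ i], so [u + e] decreases and
    [u - e] increases to the same limit, which lies within [e i] of [u i]. *)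
Lemma cvg_geometric_steps (R : realType) (u : R^nat) (c r : R) :
  0 <= r < 1 -> (forall i, `|u i.+1 - u i| <= c * (1 - r) * r ^+ i) ->
  cvgn u /\ forall i, `|limn u - u i| <= c * r ^+ i.
Proof.
move=> /andP[r0 r1] uS.
have c0 : 0 <= c.
  have := le_trans (normr_ge0 _) (uS 0%N); rewrite expr0 mulr1.
  by rewrite pmulr_lge0// subr_gt0.
pose e i := c * r ^+ i.
have eS i : e i.+1 = e i - c * (1 - r) * r ^+ i by rewrite /e exprS; ring.
have e_cvg : e @ \oo --> 0.
  by apply: cvg_geometric; rewrite ger0_norm.
have dec : nonincreasing_seq (u \+ e).
  by apply/nonincreasing_seqP => i /=; have := uS i; rewrite eS ler_norml; lra.
have inc : nondecreasing_seq (u \- e).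
  by apply/nondecreasing_seqP => i /=; have := uS i; rewrite eS ler_norml; lra.
have e0 i : 0 <= e i by rewrite mulr_ge0 ?exprn_ge0.
have cinc : cvgn (u \- e).
  apply: nondecreasing_is_cvgn => //; exists (u 0%N + e 0%N) => _ [i _ <-] /=.
  have := dec 0%N i (leq0n _); have := e0 i; rewrite /=; lra.
have ul : u @ \oo --> limn (u \- e).
  rewrite (_ : u = (u \- e) \+ e); last by apply/funext => i /=; rewrite subrK.
  rewrite -[X in _ --> X]addr0; apply: cvgD => //.
  rewrite (_ : (_ \+ e) \- e = u \- e)//.
  by apply/funext => i /=; rewrite subrK.
have cu : cvgn u by apply/cvg_ex; exists (limn (u \- e)).
split=> // i; rewrite (cvg_lim _ ul)//.
have := nondecreasing_cvgn_le inc cinc i.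
have ul2 : (u \+ e) @ \oo --> limn (u \- e).
  by rewrite -[X in _ --> X]addr0; apply: cvgD.
have := nonincreasing_cvgn_ge dec (cvgP _ ul2) i.
by rewrite (cvg_lim _ ul2)//= -/(e i) ler_norml; lra.
Qed.

Section dyadic_derivative.
Context {R : realType} {V : normedModType R}.
Variables (F : V -> R) (A : R).
Hypothesis F2 : forall p v, `|v| <= 2^-1 ^+ p -> forall x,
  `|iter 2 (fdiff v) F x| <= A * 3^-1 ^+ p.
Implicit Types (v x : V) (p i : nat).

Definition dyadic_quotient v x i : R := 2 ^+ i * fdiff (2^-1 ^+ i *: v) F x.

Definition dyadic_derive v x : R := limn (dyadic_quotient v x).

Let A0 : 0 <= A.
Proof.
have /F2/(_ 0) : `|0 : V| <= 2^-1 ^+ 0 by rewrite normr0 expr0.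
by rewrite expr0 mulr1; exact: le_trans.
Qed.

(** Halving the step changes the quotient by [2^i] times a second difference with step [2^-(i+1) v].
    Since 1/3 < 1/2, the changes decay like [(2/3)^i]; the factor [1 - 2/3] is the form required by
    [cvg_geometric_steps]. *)
Lemma dyadic_quotient_step p v x i : `|v| <= 2^-1 ^+ p ->
  `|dyadic_quotient v x i.+1 - dyadic_quotient v x i| <=
  A * 3^-1 ^+ p * (1 - 2 / 3) * (2 / 3) ^+ i.
Proof.
move=> vp; pose h := 2^-1 ^+ i.+1 *: v.
have h2 : 2^-1 ^+ i *: v = h + h.
  by rewrite -scalerDl exprS; congr (_ *: v); field.
have -> : dyadic_quotient v x i.+1 - dyadic_quotient v x i =
    - (2 ^+ i * iter 2 (fdiff h) F x).
  rewrite /dyadic_quotient h2 -/h exprS /= /fdiff addrA.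
  by ring.
have /F2 Fh : `|h| <= 2^-1 ^+ (i.+1 + p).
  by rewrite normrZ ger0_norm ?exprn_ge0// exprD ler_wpM2l ?exprn_ge0.
rewrite normrN normrM ger0_norm ?exprn_ge0//.
rewrite (le_trans (ler_wpM2l (exprn_ge0 _ _) (Fh x)))//.
rewrite exprD exprS expr_div_n exprVn.
set a := 2 ^+ i; set b := 3^-1 ^+ p; set c := 3 ^- i.
by rewrite le_eqVlt; apply/orP; left; apply/eqP; field.
Qed.

Lemma cvg_dyadic_quotient p v : `|v| <= 2^-1 ^+ p -> forall x,
  cvgn (dyadic_quotient v x) /\
  forall i, `|dyadic_derive v x - dyadic_quotient v x i| <=
    A * 3^-1 ^+ p * (2 / 3) ^+ i.
Proof.
move=> vp x; apply: cvg_geometric_steps => [|i]; first by lra.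
exact: dyadic_quotient_step.
Qed.

Lemma fdiff_dyadic_derive p v x : `|v| <= 2^-1 ^+ p ->
  `|fdiff v F x - dyadic_derive v x| <= A * 3^-1 ^+ p.
Proof.
move=> /cvg_dyadic_quotient/(_ x)[_ /(_ 0%N)].
by rewrite distrC /dyadic_quotient !expr0 mul1r scale1r mulr1.
Qed.

(** Polarisation: the middle terms [F (x + v + w)] of the two second differences cancel. Mixed
    differences are thus controlled by [F2]. *)
Lemma fdiff_mixed v w x : fdiff (v + v) (fdiff (w + w) F) x =
  iter 2 (fdiff (v + w)) F x - iter 2 (fdiff (v - w)) F (x + (w + w)).
Proof.
rewrite /= /fdiff.
have -> : x + (v + w) + (v + w) = x + (v + v) + (w + w).
  by rewrite -!addrA; congr (x + (v + _)); rewrite addrCA.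
have -> : x + (w + w) + (v - w) = x + (v + w).
  by rewrite -!addrA; congr (x + _); rewrite [w + (v - w)]addrC subrK addrC.
have -> : x + (v + w) + (v - w) = x + (v + v).
  by rewrite -!addrA; congr (x + (v + _)); rewrite addrCA subrr addr0.
by ring.
Qed.

(** The additivity defect of the quotients is [2^i] times a mixed difference with steps [2^-i v] and
    [2^-i w], hence [O((2/3)^i)]. The bounds 1/2 keep [v + w] in the unit ball, where [F2]
    applies. *)
Lemma dyadic_deriveD v w x : `|v| <= 2^-1 -> `|w| <= 2^-1 ->
  dyadic_derive (v + w) x = dyadic_derive v x + dyadic_derive w x.
Proof.
move=> v2 w2.
have v1 : `|v| <= 2^-1 ^+ 0 by rewrite expr0; lra.
have w1 : `|w| <= 2^-1 ^+ 0 by rewrite expr0; lra.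
have vw1 : `|v + w| <= 2^-1 ^+ 0.
  by rewrite expr0 (le_trans (ler_normD _ _))//; lra.
have [cv _] := cvg_dyadic_quotient v1 x.
have [cw _] := cvg_dyadic_quotient w1 x.
have [cvw _] := cvg_dyadic_quotient vw1 x.
apply/eqP; rewrite -subr_eq0 opprD addrA -normr_le0; apply/ler_addgt0Pr => e e0.
rewrite add0r.
pose D i := dyadic_quotient (v + w) x i - dyadic_quotient v x i -
   dyadic_quotient w x i.
have cD : D @ \oo --> dyadic_derive (v + w) x - dyadic_derive v x -
    dyadic_derive w x.
  by apply: cvgB => //; apply: cvgB.
have DB i : `|D i| <= 2 * A * (2 / 3) ^+ i.
  pose h := 2^-1 ^+ i.+1 *: v; pose k := 2^-1 ^+ i.+1 *: w.
  have hh : 2^-1 ^+ i *: v = h + h.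
    by rewrite -scalerDl exprS; congr (_ *: v); field.
  have kk : 2^-1 ^+ i *: w = k + k.
    by rewrite -scalerDl exprS; congr (_ *: w); field.
  have -> : D i = 2 ^+ i * fdiff (h + h) (fdiff (k + k) F) x.
    rewrite /D /dyadic_quotient scalerDr hh kk /fdiff addrA; ring.
  have i2 : 0 <= 2^-1 ^+ i.+1 :> R by rewrite exprn_ge0.
  have hki : `|h| + `|k| <= 2^-1 ^+ i.
    rewrite !normrZ ger0_norm// -mulrDr exprSr -mulrA ler_piMr ?exprn_ge0//.
    by lra.
  rewrite fdiff_mixed normrM ger0_norm ?exprn_ge0//.
  have /F2/(_ x) := le_trans (ler_normD h k) hki.
  have /F2/(_ (x + (k + k))) := le_trans (ler_normB h k) hki.
  set a := iter _ _ _ _; set b := iter _ _ _ _ => aA bA.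
  rewrite expr_div_n -mulrA [leRHS](_ : _ = 2 ^+ i * (2 * (A * 3^-1 ^+ i))).
    by rewrite ler_wpM2l ?exprn_ge0// (le_trans (ler_normB _ _))//; lra.
  by rewrite exprVn; ring.
have D0 : D @ \oo --> 0.
  apply/norm_cvg0P; apply: (@squeeze_cvgr _ _ _ _ (cst 0)
    (fun i => 2 * A * (2 / 3) ^+ i)).
  - by apply: nearW => i; rewrite /= normr_ge0 DB.
  - exact: cvg_cst.
  - by apply: cvg_geometric; rewrite ger0_norm; lra.
by rewrite -(cvg_lim _ cD)// (cvg_lim _ D0)// normr0 ltW.
Qed.

Lemma dyadic_derive_half v x : `|v| <= 1 ->
  dyadic_derive (2^-1 *: v) x = dyadic_derive v x / 2.
Proof.
move=> v1; have /cvg_dyadic_quotient/(_ x)[cv _] : `|v| <= 2^-1 ^+ 0.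
  by rewrite expr0.
have : dyadic_quotient (2^-1 *: v) x @ \oo --> dyadic_derive v x / 2.
  rewrite (_ : dyadic_quotient (2^-1 *: v) x =
    (fun i => dyadic_quotient v x i.+1 / 2)); last first.
    apply/funext => i; rewrite /dyadic_quotient scalerA -exprSr [2 ^+ i.+1]exprS.
    by field.
  by apply: cvgMr_tmp; rewrite (cvg_shiftS (dyadic_quotient v x)).
by move=> /cvg_lim; exact.
Qed.

Variable M : R.
Hypothesis FM : forall x, `|F x| <= M.

Lemma dyadic_derive_bound v x : `|v| <= 1 -> `|dyadic_derive v x| <= 2 * M + A.
Proof.
move=> v1; have /fdiff_dyadic_derive : `|v| <= 2^-1 ^+ 0 by rewrite expr0.
move=> /(_ x); rewrite mulr1 => vA.
rewrite -(subKr (fdiff v F x) (dyadic_derive v x)).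
rewrite (le_trans (ler_normB _ _))// lerD//.
by rewrite /fdiff (le_trans (ler_normB _ _))// mulr2n mulrDl !mul1r lerD.
Qed.

Lemma dyadic_derive0 x : dyadic_derive 0 x = 0.
Proof.
have : dyadic_derive (0 + 0) x = dyadic_derive 0 x + dyadic_derive 0 x.
  by apply: dyadic_deriveD; rewrite normr0.
by rewrite addr0; lra.
Qed.

(** As for Cauchy's functional equation: the homogeneity defect [k] is bounded, additive on
    [[0, 1/2]] and zero at 1, hence zero on [[0, 1]]. Negative [t] follow by additivity. *)
Lemma dyadic_deriveZ t v x : `|t| <= 1 -> `|v| <= 1 ->
  dyadic_derive (t *: v) x = t * dyadic_derive v x.
Proof.
move=> t1 v1; pose k t := dyadic_derive (t *: v) x - t * dyadic_derive v x.
suff k0 s : 0 <= s <= 1 -> k s = 0.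
  have [t0|t0] := leP 0 t.
    by apply/eqP; rewrite -subr_eq0 -/(k t) k0// t0 (le_trans _ t1)// ler_norm.
  have t01 : 0 <= - t <= 1 by move: t1; rewrite ltr0_norm//; lra.
  have tv1 : `|t *: v| <= 1 by rewrite normrZ mulr_ile1.
  have := k0 (- t) t01; rewrite /k scaleNr.
  have h2 : `|2^-1 *: (t *: v)| <= 2^-1.
    by rewrite normrZ ger0_norm// ler_piMr.
  have h2N : `|2^-1 *: - (t *: v)| <= 2^-1 by rewrite scalerN normrN.
  have := dyadic_deriveD x h2 h2N.
  rewrite -scalerDr subrr scaler0 dyadic_derive0.
  by rewrite !dyadic_derive_half ?normrN//; lra.
have kB u : 0 <= u <= 1 -> `|k u| <= 2 * (2 * M + A).
  move=> /andP[u0 u1]; rewrite /k (le_trans (ler_normB _ _))//.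
  rewrite mulr2n mulrDl !mul1r lerD//.
    by rewrite dyadic_derive_bound// normrZ ger0_norm// mulr_ile1.
  rewrite normrM ger0_norm// (le_trans _ (dyadic_derive_bound x v1))//.
  by rewrite ler_piMl.
have k1 : k 1 = 0 by rewrite /k scale1r mul1r subrr.
have khalf u : 0 <= u <= 1 -> k (2^-1 * u) = k u / 2.
  move=> /andP[u0 u1]; rewrite /k -scalerA dyadic_derive_half; first by field.
  by rewrite normrZ ger0_norm// mulr_ile1.
have kD u w : 0 <= u <= 2^-1 -> 0 <= w <= 2^-1 -> k (u + w) = k u + k w.
  move=> /andP[u0 u1] /andP[w0 w1]; rewrite /k scalerDl dyadic_deriveD.
  - by ring.
  - by rewrite normrZ ger0_norm// (le_trans _ u1)// ler_piMr.
  - by rewrite normrZ ger0_norm// (le_trans _ w1)// ler_piMr.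
(* Doubling [u] modulo 1 stays in [[0, 1]] and doubles [k], so each round halves the bound. *)
have kp p : forall s, 0 <= s <= 1 -> `|k s| <= 2 * (2 * M + A) * 2^-1 ^+ p.
  elim: p => [|p IH] u u01; first by rewrite expr0 mulr1 kB.
  have [s2|s2] := leP u 2^-1.
    have -> : k u = k (2 * u) / 2 by rewrite -khalf ?mulKf//; lra.
    have := IH (2 * u) ltac:(lra).
    by rewrite normrM (@ger0_norm _ 2^-1)// exprS; lra.
  have -> : u = 2^-1 * 1 + 2^-1 * (2 * u - 1) by field.
  rewrite kD ?khalf//; try lra.
  have := IH (2 * u - 1) ltac:(lra).
  rewrite k1 mul0r add0r normrM (@ger0_norm _ 2^-1)// exprS; lra.
move=> s01; apply/eqP; rewrite -normr_le0.
have c0 : (fun p => 2 * (2 * M + A) * 2^-1 ^+ p) @ \oo --> 0.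
  by apply: cvg_geometric; rewrite ger0_norm; lra.
rewrite -(cvg_lim _ c0)//; apply: limr_ge; first by apply/cvg_ex; exists 0.
by apply: nearW => p; exact: kp.
Qed.

End dyadic_derivative.

Lemma geometric_small (R : realType) (c r e : R) : 0 <= r < 1 -> 0 < e ->
  exists p, c * r ^+ p <= e.
Proof.
move=> /andP[r0 r1] e0.
have : (fun p => c * r ^+ p) @ \oo --> 0.
  by apply: cvg_geometric; rewrite ger0_norm.
move=> /cvgrPdist_le/(_ e e0)[p _ /(_ p (leqnn _))] /=.
by rewrite sub0r normrN => cp; exists p; rewrite (le_trans _ cp)// ler_norm.
Qed.

Lemma dyadic_scale (R : realType) (h : R) : 0 < h <= 1 ->
  exists p, 2^-1 ^+ p.+1 < h <= 2^-1 ^+ p.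
Proof.
move=> /andP[h0 h1].
have [k kh] : exists k, 2^-1 ^+ k < h.
  have [k hk] := @geometric_small R 1 2^-1 (h / 2) ltac:(lra) ltac:(lra).
  by exists k; lra.
have [] := ex_minnP (ex_intro (fun k => 2^-1 ^+ k < h) k kh).
move=> [|p]; first by rewrite expr0 ltNge h1.
move=> hp pmin; exists p; rewrite hp leNgt; apply/negP => /pmin.
by rewrite ltnn.
Qed.

Section dyadic_derivative_derive.
Context {R : realType} {V : normedModType R}.
Variables (F : V -> R) (A M : R).
Hypothesis F2 : forall p v, `|v| <= 2^-1 ^+ p -> forall x,
  `|iter 2 (fdiff v) F x| <= A * 3^-1 ^+ p.
Hypothesis FM : forall x, `|F x| <= M.

(** The derivative is a limit over all real steps [h]. For [2^-(p+1) < |h| <= 2^-p], homogeneity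
    leaves an error [A 3^-p] in the increment, which is at most [2 A (2/3)^p |h|]. *)
Lemma derive_dyadic v x : `|v| <= 1 -> 'D_v F x = dyadic_derive F v x.
Proof.
move=> v1; apply: cvg_lim => //; apply/cvgrPdist_le => e e0.
have A0 : 0 <= A.
  have /F2/(_ 0) : `|0 : V| <= 2^-1 ^+ 0 by rewrite normr0 expr0.
  by rewrite expr0 mulr1; exact: le_trans.
have [P Pe] := @geometric_small R (2 * A) (2 / 3) e ltac:(lra) e0.
rewrite near_withinE; apply/nbhs_ballP; exists (2^-1 ^+ P) => [/=|h].
  by rewrite exprn_gt0.
rewrite /ball/= sub0r normrN => hP h0.
have h_gt0 : 0 < `|h| by rewrite normr_gt0.
have h1 : `|h| <= 1 by rewrite (le_trans (ltW hP))// exprn_ile1//; lra.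
have [p /andP[ph hp]] := @dyadic_scale R `|h| ltac:(lra).
have Pp : (P <= p)%N.
  rewrite -ltnS -(@ltr_iXn2l R 2^-1); [|lra|lra].
  exact: lt_trans ph hP.
have hv : `|h *: v| <= 2^-1 ^+ p by rewrite normrZ (le_trans _ hp)// ler_piMr.
have := fdiff_dyadic_derive F2 x hv.
rewrite (dyadic_deriveZ F2 FM)// => hvA.
rewrite /= [h *: v + x]addrC -/(fdiff (h *: v) F x).
rewrite -(mulKf h0 (dyadic_derive _ _ _)) -mulrBr normrM normfV distrC.
rewrite ler_pdivrMl// (le_trans hvA)//.
have -> : A * 3^-1 ^+ p = 2^-1 ^+ p.+1 * (2 * A * (2 / 3) ^+ p).
  rewrite exprS expr_div_n mulrACA [2^-1 * _]mulKf//.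
  rewrite !exprVn; field; rewrite ?expf_neq0//.
have r0 : 0 <= (2 / 3 : R) by lra.
apply: ler_pM; [by rewrite exprn_ge0| |exact: ltW|].
  by rewrite mulr_ge0 ?exprn_ge0 ?mulr_ge0.
rewrite (le_trans _ Pe)// ler_wpM2l ?mulr_ge0//.
by apply: ler_wiXn2l => //; lra.
Qed.

(** Writing [v = 2^-p w] with [|w| <= 1], the increment is [2^-p] times a bounded derivative plus an
    error [A 3^-p <= A 2^-p]. *)
Lemma fdiff_lipschitz p v x : `|v| <= 2^-1 ^+ p ->
  `|fdiff v F x| <= (2 * M + 2 * A) * 2^-1 ^+ p.
Proof.
move=> vp; have p0 : 0 < 2^-1 ^+ p :> R by rewrite exprn_gt0.
have [w w1 vE] : exists2 w : V, `|w| <= 1 & v = 2^-1 ^+ p *: w.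
  exists ((2^-1 ^+ p)^-1 *: v); last by rewrite scalerA mulfV ?gt_eqF// scale1r.
  by rewrite normrZ gtr0_norm ?invr_gt0// ler_pdivrMl// mulr1.
have dE : dyadic_derive F v x = 2^-1 ^+ p * dyadic_derive F w x.
  rewrite vE (dyadic_deriveZ F2 FM)// gtr0_norm//.
  by apply: exprn_ile1 => //; lra.
have := fdiff_dyadic_derive F2 x vp; rewrite dE.
have := dyadic_derive_bound F2 FM x w1.
move=> wB vB; rewrite -(subrK (2^-1 ^+ p * dyadic_derive F w x) (fdiff v F x)).
rewrite (le_trans (ler_normD _ _))// normrM gtr0_norm//.
have := ler_wpM2l (ltW p0) wB.
have : A * 3^-1 ^+ p <= A * 2^-1 ^+ p.
  have A0 : 0 <= A.
    have /F2/(_ 0) : `|0 : V| <= 2^-1 ^+ 0 by rewrite normr0 expr0.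
    by rewrite expr0 mulr1; exact: le_trans.
  by rewrite ler_wpM2l// lerXn2r ?nnegrE//; lra.
lra.
Qed.

End dyadic_derivative_derive.

(** * Zygmund-Hoelder conditions and differentiation *)

(** The two functions may live on different groups, so that differences at real points can be
    compared with differences at rational ones. *)
Lemma iter_fdiff_near (R : realType) (V W : zmodType) (F : V -> R) (G : W -> R)
    (y : V) (z : W) (e : R) m : forall x t,
  (forall i, (i <= m)%N -> `|F (x + y *+ i) - G (t + z *+ i)| <= e) ->
  `|iter m (fdiff y) F x - iter m (fdiff z) G t| <= 2 ^+ m * e.
Proof.
elim: m => [|m IH] x t FG.
  by have := FG 0%N (leqnn _); rewrite !mulr0n !addr0 expr0 mul1r.
have H1 := IH x t (fun i im => FG i (leqW im)).
have H2 : `|iter m (fdiff y) F (x + y) - iter m (fdiff z) G (t + z)| <= 2 ^+ m * e.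
  by apply: IH => i im; rewrite -!addrA -!mulrS FG.
rewrite !iterS {1 3}/fdiff exprS -mulrA mulr2n mulrDl mul1r.
rewrite (_ : _ - _ - _ = (iter m (fdiff y) F (x + y) - iter m (fdiff z) G (t + z))
  - (iter m (fdiff y) F x - iter m (fdiff z) G t)); last by ring.
by rewrite (le_trans (ler_normB _ _))// lerD.
Qed.

Lemma iter_fdiff_scale (R : realType) (V : zmodType) (F : V -> R) (y h : V)
    (c : R) m x :
  iter m (fdiff y) (fun x => c * fdiff h F x) x =
  c * fdiff h (iter m (fdiff y) F) x.
Proof.
elim: m x => // m IH x; rewrite !iterS /fdiff !IH /fdiff addrAC; ring.
Qed.

(* A dyadic form of the Zygmund-Hoelder condition of order q. *)
Definition dyadic_hoelder (R : realType) (V : normedModType R) (m q : nat)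
    (M : R) (F : V -> R) : Prop :=
  (forall x, `|F x| <= M) /\
  forall p y, `|y| <= 2^-1 ^+ p -> forall x,
    `|iter m (fdiff y) F x| <= M * 2^-1 ^+ (p * q).

Section dyadic_hoelder.
Context {R : realType}.

(** Order [q >= 2] gives differences of size [4^-p <= 3^-p], to which [marchaud2] applies. *)
Lemma dyadic_hoelder_fdiff2 (m : nat) : (2 <= m)%N ->
  exists2 C : R, 0 <= C & forall (V : normedModType R) (F : V -> R) (M : R) q,
    (2 <= q)%N -> dyadic_hoelder m q M F ->
    forall p v, `|v| <= 2^-1 ^+ p -> forall x,
      `|iter 2 (fdiff v) F x| <= C * M * 3^-1 ^+ p.
Proof.
move=> /(@marchaud2 R)[C C0 CP]; exists C => // V F M q q2 [FM Fm] p v vp x.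
apply: (CP V (fun p y => `|y| <= 2^-1 ^+ p)) => //= {p v x vp} p y.
  move=> yp; rewrite (le_trans (ler_normD _ _))//.
  by move: yp; rewrite exprS; lra.
move=> x yp; rewrite (le_trans (Fm p y yp x))// ler_wpM2l//.
  exact: le_trans (FM 0).
rewrite mulnC exprM lerXn2r ?nnegrE ?exprn_ge0//.
rewrite (@le_trans _ _ (2^-1 ^+ 2))//; last by lra.
by rewrite ler_wiXn2l//; lra.
Qed.

Lemma dyadic_hoelder_continuous (V : normedModType R) m q M (F : V -> R) :
  (2 <= m)%N -> (2 <= q)%N -> dyadic_hoelder m q M F -> continuous F.
Proof.
move=> /dyadic_hoelder_fdiff2[C C0 CP] q2 FH x; have F2 := CP V F M q q2 FH.
apply/cvgrPdist_le => e e0.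
have [p pe] := @geometric_small R (2 * M + 2 * (C * M)) 2^-1 e ltac:(lra) e0.
apply/nbhs_ballP; exists (2^-1 ^+ p) => [|y]; first by rewrite /= exprn_gt0.
rewrite -ball_normE/= distrC => xy.
have := fdiff_lipschitz F2 (proj1 FH) x (ltW xy).
by rewrite /fdiff [x + _]addrC subrK distrC => /le_trans; apply.
Qed.

(** The derivative is compared with a difference quotient at a much finer scale; balancing the two
    errors costs a factor 3 in the order. *)
Lemma dyadic_hoelder_derive (m : nat) : (2 <= m)%N ->
  exists2 C : R, 0 <= C & forall (V : normedModType R) (F : V -> R) (M : R) q v,
    (0 < q)%N -> `|v| <= 1 -> dyadic_hoelder m (3 * q) M F ->
    dyadic_hoelder m q (C * M) ('D_v F).
Proof.
move=> /dyadic_hoelder_fdiff2[C C0 CP].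
exists (2 + 2 ^+ m * C) => [|V F M q v q0 v1 FH].
  by rewrite addr_ge0// mulr_ge0 ?exprn_ge0.
have q2 : (2 <= 3 * q)%N by rewrite (leq_trans _ (leq_pmulr _ q0)).
have F2 := CP V F M _ q2 FH.
have [FM Fm] := FH.
have M0 : 0 <= M by exact: le_trans (FM 0).
have CM0 : 0 <= C * M by rewrite mulr_ge0.
have -> : 'D_v F = dyadic_derive F v.
  by apply/funext => x; rewrite (derive_dyadic F2 FM).
rewrite /dyadic_hoelder mulrDl -mulrA; split => [x|p y yp x].
  rewrite (le_trans (dyadic_derive_bound F2 FM x v1))// lerD2l.
  by rewrite ler_peMl// exprn_ege1// ler1n.
(* With step [2^-i], the comparison error [(2/3)^i = (4/9)^(pq)] is at most [2^-(pq)], and dividing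
   by the step turns the exponent [3pq] of the [m]-th differences into [3pq - 2pq = pq]. *)
pose i := (2 * (p * q))%N.
have near_i t : `|dyadic_derive F v t - dyadic_quotient F v t i| <=
    C * M * 2^-1 ^+ (p * q).
  have /(cvg_dyadic_quotient F2)/(_ t)[_ /(_ i)] : `|v| <= 2^-1 ^+ 0.
    by rewrite expr0.
  rewrite mulr1 => /le_trans; apply; rewrite ler_wpM2l//.
  by rewrite /i exprM lerXn2r ?nnegrE ?sqr_ge0//; lra.
have := @iter_fdiff_near R V V (dyadic_derive F v)
  (fun t => dyadic_quotient F v t i) y y _ m x x (fun j _ => near_i (x + y *+ j)).
rewrite [X in _ - X]iter_fdiff_scale => H.
rewrite -(subrK (2 ^+ i * fdiff (2^-1 ^+ i *: v) (iter m (fdiff y) F) x)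
  (iter m (fdiff y) (dyadic_derive F v) x)).
rewrite (le_trans (ler_normD _ _))// addrC mulrDl lerD//; last by rewrite -mulrA.
have -> : 2 * M * 2^-1 ^+ (p * q) = 2 ^+ i * (2 * (M * 2^-1 ^+ (p * (3 * q)))).
  have -> : (p * (3 * q) = i + p * q)%N by rewrite /i mulnCA -mulSnr.
  have i1 : 2 ^+ i * 2^-1 ^+ i = 1 :> R by rewrite -exprMn mulfV ?expr1n.
  transitivity (2 ^+ i * 2^-1 ^+ i * (2 * M * 2^-1 ^+ (p * q))).
    by rewrite i1 mul1r.
  rewrite exprD; move: (2^-1 ^+ i) (2^-1 ^+ (p * q)) (2 ^+ i) => a b c; ring.
rewrite normrM (ger0_norm (exprn_ge0 _ _))// ler_wpM2l ?exprn_ge0//.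
rewrite /fdiff (le_trans (ler_normB _ _))// mulr2n mulrDl mul1r.
by rewrite lerD// Fm.
Qed.

End dyadic_hoelder.

(** * Extension from a rational coset *)

Section partials.
Context {R : realType} {n : nat}.
Local Notation E := 'rV[R]_n.+1.
Implicit Types (F : E -> R) (w : seq 'I_n.+1).

Lemma normr_rV_le (x : E) (e : R) : 0 <= e ->
  (forall i, `|x 0 i| <= e) -> `|x| <= e.
Proof.
move=> e0 xe; rewrite /Num.norm/= mx_normrE; apply/bigmax_leP; split=> // -[i j] _.
by rewrite ord1 xe.
Qed.

Lemma coord_le_normr (x : E) i : `|x 0 i| <= `|x|.
Proof.
rewrite {2}/Num.norm/= mx_normrE.
exact: (le_bigmax _ (fun ij => `|x ij.1 ij.2|) (0, i)).
Qed.

(** Each derivative divides the order by 3, whence the power of 3. *)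
Lemma dyadic_hoelder_partials m w : (2 <= m)%N ->
  exists2 C : R, 0 <= C & forall F M q, (0 < q)%N ->
    dyadic_hoelder m (3 ^ size w * q) M F ->
    dyadic_hoelder m q (C * M) (partials w F).
Proof.
move=> m2; elim: w => [|i w [C C0 IH]].
  by exists 1 => // F M q q0; rewrite mul1n mul1r.
have [C1 C10 C1P] := @dyadic_hoelder_derive R m m2.
exists (C1 * C) => [|F M q q0]; first by rewrite mulr_ge0.
rewrite /= expnSr -mulnA => /IH; rewrite muln_gt0 q0 => /(_ isT) H.
rewrite -mulrA; apply: C1P => //; apply: normr_rV_le => // j.
by rewrite mxE; case: (_ && _); rewrite ?normr0 ?normr1.
Qed.

Lemma eq_partials_open (A : set E) (f g : E -> R) w : open A ->
  (forall x, A x -> f x = g x) -> forall x, A x -> partials w f x = partials w g x.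
Proof.
move=> oA fg; elim: w => //= i w IH x Ax; apply: near_eq_derive.
by apply: filterS IH _; exact: open_nbhs_nbhs.
Qed.

End partials.

Section rational_coset.
Context {R : realType} {n : nat}.
Local Notation E := 'rV[R]_n.+1.
Local Notation Q := 'rV[rat]_n.+1.
Local Notation iota := (map_mx (@ratr R) : Q -> E).

Lemma dense_rational (x : E) (e : R) : 0 < e -> exists r : Q, `|x - iota r| <= e.
Proof.
move=> e0; have rP i : {q : rat | `|x 0 i - ratr q| <= e}.
  apply: cid.
  have /rat_in_itvoo[q] : x 0 i - e < x 0 i + e by lra.
  by rewrite in_itv/= => qi; exists q; rewrite ler_norml; lra.
exists (\row_i sval (rP i)); apply: normr_rV_le => [|i]; first exact: ltW.
by rewrite !mxE; exact: svalP (rP i).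
Qed.

(** [F] is a function on the coset [x0 + Q^d], indexed by [Q^d]. Shifts up to twice [2^-p] are
    allowed because a rational approximation of a real [y] with [|y| <= 2^-p] may be longer than
    [y]. *)
Lemma rational_coset_extension (x0 : E) (m q : nat) (M : R) (F : Q -> R) :
  (2 <= m)%N -> (2 <= q)%N -> (forall r, `|F r| <= M) ->
  (forall p s, `|iota s| <= 2 * 2^-1 ^+ p -> forall r,
    `|iter m (fdiff s) F r| <= M * 2^-1 ^+ (p * q)) ->
  exists2 G : E -> R, dyadic_hoelder m q M G &
    forall e, 0 < e -> exists2 d, 0 < d &
      forall x r, `|x - (x0 + iota r)| <= d -> `|G x - F r| <= e.
Proof.
move=> m2 q2 FM Fm.
have h0 k : 0 < 2^-1 ^+ k :> R by rewrite exprn_gt0.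
pose B p (s : Q) := `|iota s| <= 2^-1 ^+ p.
have M0 : 0 <= M by exact: le_trans (FM 0).
have B2 p s : B p.+1 s -> B p (s + s).
  rewrite /B raddfD => sp; rewrite (le_trans (ler_normD _ _))//.
  by move: sp; rewrite exprS; lra.
have Fm3 p s r : B p s -> `|iter m (fdiff s) F r| <= M * 3^-1 ^+ p.
  move=> sp; have p0 : 0 <= 2^-1 ^+ p :> R by rewrite exprn_ge0.
  have /Fm/(_ r) : `|iota s| <= 2 * 2^-1 ^+ p by rewrite (le_trans sp)//; lra.
  move=> /le_trans; apply; rewrite ler_wpM2l//.
  rewrite mulnC exprM lerXn2r ?nnegrE ?exprn_ge0//.
  rewrite (@le_trans _ _ (2^-1 ^+ 2))//; last by lra.
  by rewrite ler_wiXn2l//; lra.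
have [C C0 CP] := marchaud2 R m2.
have F2 := CP _ B B2 F M FM Fm3.
(* A last descent, from second to first differences at the rate 2/3, for which [1/2 = 3/4 * 2/3],
   makes [F] uniformly continuous. *)
have := @marchaud_step R _ B B2 F 1 (2 / 3) M (C * M) ltac:(lra) ltac:(lra) FM.
set A := 2 ^+ 1 * M + _.
have A0 : 0 <= A by rewrite /A addr_ge0 ?mulr_ge0.
have F2' p s r : B p s -> `|iter 2 (fdiff s) F r| <= C * M * (2 / 3) ^+ p.
  move=> sp; rewrite (le_trans (F2 p s r sp))// ler_wpM2l ?mulr_ge0//.
  by rewrite lerXn2r ?nnegrE//; lra.
move=> /(_ F2') H1.
have {H1}F1 p s : B p s -> forall r, `|F (r + s) - F r| <= A * (2 / 3) ^+ p.
  by move=> sp r; exact: H1.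
have Fr k (x : E) r s : `|x - (x0 + iota r)| <= 2^-1 ^+ k.+1 ->
    `|x - (x0 + iota s)| <= 2^-1 ^+ k.+1 -> `|F r - F s| <= A * (2 / 3) ^+ k.
  move=> xr xs; have /F1/(_ s) : B k (r - s); last by rewrite [s + _]addrC subrK.
  rewrite /B (_ : iota (r - s) = (x - (x0 + iota s)) - (x - (x0 + iota r))).
    by rewrite (le_trans (ler_normB _ _))//; move: xr xs; rewrite exprS; lra.
  by rewrite raddfB /= opprB [RHS]addrC subrKA opprD addrACA subrr add0r.
(* [G x] will be the limit of [F] along rational approximations of [x - x0]; two of them at distance
   at most [2^-(k+1)] from it differ by at most [2^-k]. *)
have aP (x : E) k : {r : Q | `|x - (x0 + iota r)| <= 2^-1 ^+ k.+1}.
  apply: cid; have [r xr] := @dense_rational (x - x0) (2^-1 ^+ k.+1)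
    (h0 _).
  by exists r; rewrite opprD addrA.
pose a x k := F (sval (aP x k)).
have aS x k : `|a x k.+1 - a x k| <= 3 * A * (1 - 2 / 3) * (2 / 3) ^+ k.
  rewrite (_ : 3 * A * _ = A); last by field.
  apply: (Fr k x); last exact: svalP (aP x k).
  rewrite (le_trans (svalP (aP x k.+1)))// ler_wiXn2l//; lra.
pose G x : R := limn (a x).
have Gr k x r : `|x - (x0 + iota r)| <= 2^-1 ^+ k.+1 ->
    `|G x - F r| <= 4 * A * (2 / 3) ^+ k.
  move=> xr; have [|_ /(_ k)] := cvg_geometric_steps _ (aS x); first by lra.
  rewrite -/(G x) => H; rewrite -(subrK (a x k) (G x)) -[_ - F r]addrA.
  have := Fr k x _ r (svalP (aP x k)) xr; rewrite -/(a x k) => H'.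
  rewrite (le_trans (ler_normD _ _))//.
  by rewrite (_ : 4 * A * _ = 3 * A * (2 / 3) ^+ k + A * (2 / 3) ^+ k) ?lerD//;
    ring.
have Gnear e : 0 < e -> exists k, forall x r,
    `|x - (x0 + iota r)| <= 2^-1 ^+ k -> `|G x - F r| <= e.
  move=> e0; have [k ke] := @geometric_small R (4 * A) (2 / 3) e ltac:(lra) e0.
  by exists k.+1 => x r /Gr/le_trans; apply.
exists G => [|e /Gnear[k kP]]; last first.
  by exists (2^-1 ^+ k) => //; rewrite exprn_gt0.
split=> [x|p y yp x]; apply/ler_addgt0Pr => e e0.
  have [k kP] := Gnear e e0.
  have [r xr] := @dense_rational (x - x0) (2^-1 ^+ k) (h0 _).
  have := kP x r; rewrite opprD addrA => /(_ xr) GF.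
  rewrite -(subrK (F r) (G x)) addrC (le_trans (ler_normD _ _))//.
  by rewrite lerD.
have m0 : 0 < 2 ^+ m :> R by rewrite exprn_gt0.
have [k kP] := Gnear (e / 2 ^+ m) (divr_gt0 e0 m0).
(* The first bound keeps the error of [x + i y] below [2^-k] for all [i <= m], being added at most
   [m + 1] times; the second one keeps [|s| <= 2 * 2^-p]. *)
have d0 : 0 < Num.min (2^-1 ^+ k / m.+1%:R) (2^-1 ^+ p) :> R.
  by rewrite lt_min divr_gt0 ?exprn_gt0.
have [r xr] := dense_rational (x - x0) d0.
have [s ys] := dense_rational y d0.
have sp : `|iota s| <= 2 * 2^-1 ^+ p.
  rewrite -(subKr y (iota s)) (le_trans (ler_normB _ _))// mulr2n mulrDl mul1r.
  by rewrite lerD// (le_trans ys)// ge_min lexx orbT.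
have := @iter_fdiff_near R _ _ G F y s (e / 2 ^+ m) m x r.
have GF i : (i <= m)%N -> `|G (x + y *+ i) - F (r + s *+ i)| <= e / 2 ^+ m.
  move=> im; apply: kP; rewrite [iota _]raddfD /= [iota (s *+ i)]raddfMn /=.
  rewrite addrA opprD addrACA -mulrnBl opprD addrA.
  rewrite (le_trans (ler_normD _ _))//.
  have dk : Num.min (2^-1 ^+ k / m.+1%:R) (2^-1 ^+ p) *+ m.+1 <= 2^-1 ^+ k :> R.
    by rewrite -[leLHS]mulr_natr -ler_pdivlMr// ge_min lexx.
  rewrite (le_trans _ dk)// mulrS lerD//.
  rewrite normrMn (@le_trans _ _ (`|y - iota s| *+ m))//.
    by rewrite ler_wpMn2l.
  by rewrite lerMn2r ys orbT.
move=> /(_ GF); rewrite mulrC divfK ?gt_eqF// => H.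
rewrite -(subrK (iter m (fdiff s) F r) (iter m (fdiff y) G x)) addrC.
by rewrite (le_trans (ler_normD _ _))// lerD// Fm.
Qed.

End rational_coset.

(** * Translation invariance of Lebesgue measure *)

Section lebesgue_rV_translation.
Context {R : realType}.

(** Both measures agree on the intervals []a, b]], which determine Lebesgue measure. *)
Lemma lebesgue_measure_shift (c : R) (A : set R) : measurable A ->
  pushforward lebesgue_measure
    (fun t : measurableTypeR R => t + c : measurableTypeR R) A =
  lebesgue_measure A.
Proof.
have mc : measurable_fun setT (fun t : measurableTypeR R => t + c : measurableTypeR R).
  exact: measurable_funD.
pose f : {mfun measurableTypeR R >-> measurableTypeR R} :=
  HB.pack (fun t : measurableTypeR R => t + c) (isMeasurableFun.Build _ _ _ _ _ mc).
move=> mA; apply/esym.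
rewrite -[RHS]/(pushforward lebesgue_measure f A).
apply: lebesgue_measure_unique => //.
move=> _ [[a b]] _ <-.
rewrite -[RHS]/(lebesgue_measure (f @^-1` `]a, b]%classic)).
rewrite (_ : f @^-1` _ = `]a - c, b - c]%classic).
  rewrite !lebesgue_measure_itv/= !lte_fin ltrD2r -!EFinD.
  by case: ifPn => // _; congr EFin; ring.
by apply/seteqP; split => t /=; rewrite !in_itv/= ltrBlDr lerBrDr.
Qed.

Lemma ge0_integral_shift (c : R) (f : measurableTypeR R -> \bar R) :
  measurable_fun [set: measurableTypeR R] f -> (forall t, 0 <= f t)%E ->
  (\int[lebesgue_measure]_t f (t + c)%R = \int[lebesgue_measure]_t f t)%E.
Proof.
move=> mf f0.
have mc : measurable_fun setT (fun t : measurableTypeR R => t + c : measurableTypeR R).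
  exact: measurable_funD.
have := @ge0_integral_pushforward _ _ _ _ R _ mc lebesgue_measure setT f
  measurableT mf (fun y _ => f0 y).
rewrite preimage_setT => <-.
by apply: eq_measure_integral => A mA _ /=; rewrite -[RHS](lebesgue_measure_shift c).
Qed.

(** Induction on the dimension: the slices are shifted by the tail of [a], the outer integral by its
    first coordinate. *)
Lemma lebesgue_rV_shift n (a : 'rV[R]_n) (A : set 'rV[R]_n) : measurable A ->
  lebesgue_rV [set x | A (x + a)] = lebesgue_rV A.
Proof.
elim: n a A => [|n IH] a A mA.
  by congr lebesgue_rV; apply/funext => x /=; congr A; apply/rowP; case.
pose A' (z : measurableTypeR R * 'rV[R]_n) := A (rV_cons z.1 z.2).
have mA' : measurable A'.
  by rewrite -[X in measurable X]setTI; exact: measurable_rV_cons.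
pose phi t := lebesgue_rV (xsection A' t).
have phiE t : lebesgue_rV [set y | A (rV_cons t y)] = phi t.
  by congr lebesgue_rV; apply/seteqP; split=> y; rewrite /xsection/= inE.
rewrite /=; under [RHS]eq_integral do rewrite phiE.
rewrite -[RHS](ge0_integral_shift (a 0 0)).
- apply: eq_integral => t _; rewrite -phiE.
  rewrite -[RHS](IH (\row_j a 0 (lift 0 j))).
    congr lebesgue_rV; apply/funext => y /=; congr A; apply/rowP => i.
    rewrite !mxE; case: (unliftP 0 i) => [j ->|->] //=.
    by rewrite !mxE.
  rewrite [X in measurable X](_ : _ = xsection A' (t + a 0 0)).
    exact: measurable_xsection.
  by apply/seteqP; split=> y; rewrite /xsection/= inE.
- exact: measurable_fun_xsection.
- by move=> t; exact: measure_ge0.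
Qed.

Lemma lebesgue_rV_setT_gt0 n : (0 < lebesgue_rV [set: 'rV[R]_n])%E.
Proof.
elim: n => [|n IH] /=; first by rewrite diracT lte01.
rewrite (_ : (fun t => _) = cst (lebesgue_rV [set: 'rV[R]_n]))//.
rewrite integral_cst// mule_gt0//.
have := @lebesgue_measure_itv R `]-oo, +oo[; rewrite set_itvNyy /= => ->.
exact: ltry.
Qed.

Lemma ae_translate n (a : 'rV[R]_n) (P : 'rV[R]_n -> Prop) :
  {ae @lebesgue_rV R n, forall x, P x} ->
  {ae @lebesgue_rV R n, forall x, P (x + a)}.
Proof.
move=> [B [mB B0 PB]]; exists [set x | B (x + a)]; split.
- have mf : measurable_fun setT (fun x : 'rV[R]_n => x + a).
    apply: measurable_fun_rVP => i.
    under eq_fun do rewrite mxE.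
    by apply: measurable_funD => //; exact: measurable_coord.
  by rewrite -[X in measurable X]setTI; exact: mf.
- by rewrite [LHS]lebesgue_rV_shift.
- by move=> x /= Px; apply: PB.
Qed.

Lemma ae_forall_count n (I : countType) (P : I -> 'rV[R]_n -> Prop) :
  (forall i, {ae @lebesgue_rV R n, forall x, P i x}) ->
  {ae @lebesgue_rV R n, forall x, forall i, P i x}.
Proof.
move=> aeP.
have : {ae @lebesgue_rV R n, forall x, forall k : nat,
    if unpickle k is Some i then P i x else True}.
  apply/ae_foralln => k; case: unpickle => [i|]; first exact: aeP.
  by apply: nearW.
by apply: filterS => x Px i; have := Px (pickle i); rewrite pickleK.
Qed.

(** A null set is not the whole space, which has positive measure. *)
Lemma ae_exists n (P : 'rV[R]_n -> Prop) :
  {ae @lebesgue_rV R n, forall x, P x} -> exists x, P x.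
Proof.
move=> aeP; apply: (@filter_ex _ (almost_everywhere (@lebesgue_rV R n))) => //.
by apply: ae_properfilter_algebraOfSetsType; exact: lebesgue_rV_setT_gt0.
Qed.

End lebesgue_rV_translation.

(** * Besov spaces with p = +oo *)

Section besov_extension.
Context {R : realType} {n : nat}.
Local Notation E := 'rV[R]_n.+1.
Local Notation Q := 'rV[rat]_n.+1.
Local Notation leb := (@lebesgue_rV R n.+1).
Local Notation iota := (map_mx (@ratr R) : Q -> E).
Implicit Types (F G f g : E -> R) (A : set E) (x y : E).

Lemma enorm_ge0 x : 0 <= enorm x.
Proof. exact: sqrtr_ge0. Qed.

Lemma enorm_le_normr x : enorm x <= n.+1%:R * `|x|.
Proof.
have nx : 0 <= n.+1%:R * `|x| by rewrite mulr_ge0.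
rewrite -[leRHS]ger0_norm// -sqrtr_sqr /enorm ler_wsqrtr//.
rewrite (@le_trans _ _ (\sum_(i < n.+1) `|x| ^+ 2))//.
  apply: ler_sum => i _; rewrite -[leLHS]real_normK ?num_real//.
  by rewrite lerXn2r ?nnegrE// coord_le_normr.
rewrite sumr_const card_ord -[leLHS]mulr_natl exprMn ler_wpM2r ?sqr_ge0//.
by rewrite -natrX ler_nat -{1}[n.+1]expn1 leq_pexp2l.
Qed.

(** By Pascal's rule; this makes the estimates on iterated differences available for the Besov
    norm. *)
Lemma differenceE m y F : difference m y F = iter m (fdiff y) F.
Proof.
elim: m => [|m IH]; apply/funext => x.
  by rewrite /difference big_ord_recl big_ord0 /= subn0 expr0 bin0 !mul1r addr0
    scale0r addr0.
rewrite iterS -IH /fdiff /difference {IH}.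
rewrite big_ord_recl /= subn0 bin0 scale0r addr0 mulr1.
under eq_bigr => i _.
  rewrite /bump /= add1n subSS binS natrD mulrDr mulrDl.
  over.
rewrite big_split /= [in X in _ + (X + _)]big_ord_recr /= bin_small// mulr0 mul0r addr0.
rewrite [in RHS](_ : \sum_(i < m.+1) _ * _ * F (x + i%:R *: y) =
   (-1) ^+ m * F x - \sum_(i < m)
     (-1) ^+ (m - i) * 'C(m, i.+1)%:R * F (x + i.+1%:R *: y)).
  rewrite (_ : \sum_(i < m.+1) _ * _ * F (x + i.+1%:R *: y) =
    \sum_(i < m.+1) (-1) ^+ (m - i) * 'C(m, i)%:R * F (x + y + i%:R *: y)).
    by rewrite exprS; ring.
  apply: eq_bigr => i _; congr (_ * F _).
  by rewrite -addrA -natr1 scalerDl scale1r [y + _]addrC.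
rewrite big_ord_recl /= subn0 bin0 scale0r addr0 mulr1; congr (_ + _).
rewrite -sumrN; apply: eq_bigr => i _; rewrite /bump /= add1n.
by rewrite -(subnSK (ltn_ord i)) exprS mulN1r !mulNr opprK.
Qed.

(* F extends f from A, and M bounds the two terms of its Besov norm with
   p = +oo. *)
Definition besov_extension A (s : R) f M F : Prop :=
  [/\ {ae leb, forall x, A x -> F x = f x},
      {ae leb, forall x, `|F x| <= M} &
      forall y, y != 0 -> {ae leb, forall x,
        `|difference (Num.truncn s).+1 y F x| <= M * enorm y `^ s}].

Lemma Lp_norm_oo_le F (M : R) :
  (Lp_norm +oo%E F <= M%:E)%E <-> {ae leb, forall x, `|F x| <= M}.
Proof.
rewrite /Lp_norm unlock lebesgue_rV_setT_gt0; split=> [/ess_supP|FM].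
  by apply: filterS => x /=; rewrite lee_fin.
by apply/ess_supP; apply: filterS FM => x /=; rewrite lee_fin.
Qed.

(** The quotient norm is an infimum, so a strict bound holds for the norm of some extension; both
    terms of that norm are nonnegative, so each is at most [M]. *)
Lemma besov_norm_oo_ltP A (s : R) f (M : R) :
  (besov_norm A s +oo%E f < M%:E)%E -> exists F, besov_extension A s f M F.
Proof.
move=> /ereal_inf_lt[_ [F [mF Ff] <-]].
rewrite /besov_norm_full; set S := ereal_sup _ => FS.
have L0 : (0 <= Lp_norm +oo%E F)%E by exact: Lnorm_ge0.
have Sge y : y != 0 -> (Lp_norm +oo%E (difference (Num.truncn s).+1 y F) *
    (enorm y `^ (- s))%:E <= S)%E.
  by move=> y0; apply: ereal_sup_ubound; exists y.
have S0 : (0 <= S)%E.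
  (* The supremum [S] is nonnegative because nonzero shifts exist; the vector of ones is one. *)
  apply: le_trans (Sge (const_mx 1) _).
    by apply: mule_ge0; [exact: Lnorm_ge0|rewrite lee_fin powR_ge0].
  by apply/eqP => /rowP/(_ ord0); rewrite !mxE => /eqP; rewrite oner_eq0.
exists F; split=> //.
  by apply/Lp_norm_oo_le; rewrite (le_trans _ (ltW FS))// leeDl.
move=> y y0; apply/Lp_norm_oo_le.
have y_gt0 : 0 < enorm y.
  rewrite lt_neqAle enorm_ge0 andbT eq_sym sqrtr_eq0 -ltNge.
  have [i yi] : exists i, y 0 i != 0 by apply/rV0Pn.
  rewrite (bigD1 i)//= ltr_pwDl ?exprn_even_gt0//.
  by apply: sumr_ge0 => j _; exact: sqr_ge0.
have := le_trans (Sge y y0) (le_trans (leeDr S L0) (ltW FS)).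
by rewrite powRN lee_pdivrMr ?powR_gt0.
Qed.

(** This puts back one term of the expansion: [f] will be the remainder of order [K + 1], [c] the
    power [gamma ^+ K.+1] and [g] the function [v K.+1]. *)
Lemma besov_extensionD A s f g (M K c : R) F G : 0 <= c ->
  besov_extension A s f M F -> besov_extension A s g K G ->
  besov_extension A s (fun x => f x + c * g x) (M + c * K)
    (fun x => F x + c * G x).
Proof.
move=> c0 [Ff FM Fd] [Gg GK Gd]; split.
- by apply: filterS2 Ff Gg => x Ffx Ggx Ax; rewrite Ffx// Ggx.
- apply: filterS2 FM GK => x Fx Gx; rewrite (le_trans (ler_normD _ _))// lerD//.
  by rewrite normrM ger0_norm// ler_wpM2l.
- move=> y y0; apply: filterS2 (Fd y y0) (Gd y y0) => x Fx Gx.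
  set m := (_.+1) in Fx Gx *.
  have -> : difference m y (fun x => F x + c * G x) x =
      difference m y F x + c * difference m y G x.
    rewrite /difference mulr_sumr -big_split /=; apply: eq_bigr => i _; ring.
  rewrite mulrDl -mulrA (le_trans (ler_normD _ _))// lerD//.
  by rewrite normrM ger0_norm// ler_wpM2l.
Qed.

Lemma besov_extension_hoelder (q : nat) (s : R) : (2 <= q)%N ->
  q%:R <= s < q.+1%:R ->
  exists2 C : R, 0 <= C & forall A f M F, open A ->
    (forall x, A x -> {for x, continuous f}) -> besov_extension A s f M F ->
    exists2 G : E -> R, dyadic_hoelder q.+1 q (C * M) G &
      forall x, A x -> G x = f x.
Proof.
move=> q2 qs; have s0 : 0 <= s by case/andP: qs => + _; exact: le_trans.
have truncs : Num.truncn s = q by exact: truncn_def.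
(* A shift of sup norm at most [2 * 2^-p] has Euclidean norm at most [2 (n + 1) 2^-p]; [b] is the
   constant that results in the Besov bound. *)
pose b : R := (2 * n.+1%:R) `^ s.
have b0 : 0 <= b by exact: powR_ge0.
exists (1 + b) => [|A f M F oA cf [Ff FM Fd]]; first by rewrite addr_ge0.
rewrite truncs in Fd.
(* Such an [x0] exists because the conditions are countably many, indexed by rational [r] and [t],
   and each holds for almost every [x0] by translation invariance. *)
have H : exists x0 : E, forall r : Q, [/\ A (x0 + iota r) -> F (x0 + iota r) =
    f (x0 + iota r), `|F (x0 + iota r)| <= M & forall t : Q, iota t != 0 ->
    `|difference q.+1 (iota t) F (x0 + iota r)| <= M * enorm (iota t) `^ s].
  apply: ae_exists; apply: ae_forall_count => r.
  apply: (@ae_translate R _ (iota r) (fun x => [/\ A x -> F x = f x, `|F x| <= M &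
     forall t : Q, iota t != 0 ->
    `|difference q.+1 (iota t) F x| <= M * enorm (iota t) `^ s])).
  have : {ae leb, forall x, forall t : Q, iota t != 0 ->
      `|difference q.+1 (iota t) F x| <= M * enorm (iota t) `^ s}.
    apply: ae_forall_count => t; have [->|t0] := eqVneq (iota t) 0.
      by apply: nearW.
    by apply: filterS (Fd _ t0) => x.
  by apply: filterS3 Ff FM => x.
have [x0 x0P] := H.
have M0 : 0 <= M by have [_ + _] := x0P 0; exact: le_trans.
have CM : M <= (1 + b) * M by rewrite mulrDl mul1r lerDl mulr_ge0.
pose F0 (r : Q) := F (x0 + iota r).
have F0M r : `|F0 r| <= (1 + b) * M.
  by have [_ + _] := x0P r => /le_trans; apply.
have F0E t r : iter q.+1 (fdiff t) F0 r = iter q.+1 (fdiff (iota t)) F (x0 + iota r).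
  elim: (q.+1) r => // m IH r; rewrite !iterS {1}/fdiff !IH /fdiff raddfD /=.
  by rewrite addrA.
have F0d p t : `|iota t| <= 2 * 2^-1 ^+ p -> forall r,
    `|iter q.+1 (fdiff t) F0 r| <= (1 + b) * M * 2^-1 ^+ (p * q).
  move=> tp r; rewrite F0E; have p0 : 0 <= 2^-1 ^+ p :> R by rewrite exprn_ge0.
  have rhs0 : 0 <= (1 + b) * M * 2^-1 ^+ (p * q).
    by rewrite mulr_ge0 ?exprn_ge0// (le_trans M0).
  (* The Besov bounds concern nonzero shifts; for the zero shift the difference vanishes. *)
  have [->|t0] := eqVneq (iota t) 0.
    rewrite iterS /fdiff addr0 subrr normr0//.
  have [_ _ /(_ t t0)] := x0P r; rewrite differenceE => /le_trans; apply.
  rewrite [leRHS]mulrAC [leRHS]mulrC ler_wpM2l//.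
  have tb : enorm (iota t) <= 2 * n.+1%:R * 2^-1 ^+ p.
    rewrite (le_trans (enorm_le_normr _))// mulrAC [leRHS]mulrC ler_wpM2l//.
  rewrite (le_trans (ge0_ler_powR s0 _ _ tb)) ?nnegrE ?enorm_ge0 ?mulr_ge0//.
  rewrite powRM ?mulr_ge0// -/b ler_pM ?powR_ge0//; first by rewrite lerDr.
  rewrite exprM -[leRHS]powR_mulrn//; apply: ger_powR; last by case/andP: qs.
  by rewrite exprn_gt0//= exprn_ile1//; lra.
have [G GH Gnear] := @rational_coset_extension R n x0 q.+1 q _ F0 (leqW q2) q2 F0M F0d.
(* Close to [x] there are coset points in [A], where [F = f]; there [F] is close to [G x] and [f] is
   close to [f x]. *)
exists G => // x Ax; apply/eqP; rewrite -subr_eq0 -normr_le0.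
apply/ler_addgt0Pr => e e0; rewrite add0r.
have [d d0 dP] := Gnear (e / 2) ltac:(lra).
have /cvgrPdist_le/(_ (e / 2) ltac:(lra)) xf := cf x Ax.
have : \forall y \near x, A y /\ `|f x - f y| <= e / 2.
  by apply: filterS2 (open_nbhs_nbhs (conj oA Ax)) xf => y.
move=> /nbhs_ballP[k /= k0 kP].
have dk0 : 0 < Num.min d (k / 2) by rewrite lt_min d0/=; lra.
have [r xr] := dense_rational (x - x0) dk0.
move: xr; rewrite -addrA -opprD le_min => /andP[xd xk].
have [] := kP (x0 + iota r).
  by rewrite -ball_normE/= (le_lt_trans xk)//; lra.
have [fr _ _] := x0P r; move=> /fr Fr fxr.
rewrite -(subrK (F0 r) (G x)) -addrA.
rewrite (le_trans (ler_normD _ _))// [leRHS]splitr lerD//; first exact: dP.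
by rewrite /F0 Fr distrC.
Qed.

End besov_extension.

(** * Euclidean balls *)

Section euclidean_balls.
Context {R : realType} {n : nat}.
Local Notation E := 'rV[R]_n.+1.
Implicit Types (D : set E) (x c : E).

Lemma enorm_continuous : continuous (@enorm R n.+1).
Proof.
have sum_continuous : continuous (fun x : E => \sum_i x 0 i ^+ 2).
  apply: continuous_big => [|i _ x]; first exact: add_continuous.
  apply: (@continuous_comp _ _ _ (fun x : E => x 0 i) (fun t => t ^+ 2)).
    exact: coord_continuous.
  exact: exprn_continuous.
move=> x; apply: (@continuous_comp _ _ _ _ Num.sqrt); first exact: sum_continuous.
exact: sqrt_continuous.
Qed.

Lemma eball_open c (r : R) : open (eball c r).
Proof.
have cf : continuous (fun x : E => enorm (x - c)).
  move=> x; apply: (@continuous_comp _ _ _ (fun x : E => x - c) (@enorm R n.+1)).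
    by apply: continuousB; [move=> y; exact: cvg_id|exact: cst_continuous].
  exact: enorm_continuous.
apply: (@open_comp _ _ (fun x : E => enorm (x - c)) [set t | t < r]).
  by move=> x _; exact: cf.
exact: open_lt.
Qed.

Lemma open_ball_open (U : set E) : open_ball U -> open U.
Proof. by move=> [c [r [_ ->]]]; exact: eball_open. Qed.

(** The ball must also contain a given point, because continuity is later checked at arbitrary
    points of the space. *)
Lemma bounded_closure_ball D x : (exists r, D `<=` eball 0 r) ->
  exists U : set E, [/\ open_ball U, closure D `<=` U & U x].
Proof.
move=> [r Dr]; pose M := Num.max `|r| (enorm x).
have M0 : 0 <= M by rewrite le_max normr_ge0.
exists (eball 0 (M + 1)); split.
- by exists 0, (M + 1); split=> //; lra.
- have : closure D `<=` [set y | enorm y <= M].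
    have clM : closed [set y : E | enorm y <= M].
      rewrite -[X in closed X]/(@enorm R n.+1 @^-1` [set t | t <= M]).
      by apply: preimage_closed => [y _|]; [exact: enorm_continuous|exact: closed_le].
    rewrite [X in _ `<=` X](iffLR (closure_id _) clM); apply: closureS => y /Dr.
    rewrite /eball/= subr0 /M => yr.
    by rewrite le_max (le_trans (ltW yr))// ler_norm.
  by move=> DM y /DM /= yM; rewrite /eball/= subr0; lra.
- by rewrite /eball/= subr0 (@le_lt_trans _ _ M)// ?ltrDl// le_max lexx orbT.
Qed.

End euclidean_balls.

(** * Bounded continuous extensions of partial derivatives *)

Section derivative_bounds.
Context {R : realType} {n : nat}.
Local Notation E := 'rV[R]_n.+1.
Implicit Types (A D U : set E) (f : E -> R) (w : seq 'I_n.+1).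

Lemma harmonic_on_continuous A f x : harmonic_on A f -> A x ->
  {for x, continuous f}.
Proof.
by move=> hf /hf[/(_ [::] isT) df _ _]; exact: differentiable_continuous df.
Qed.

Lemma exterior_open D : open (exterior D).
Proof. by apply: closed_openC; exact: closed_closure. Qed.

(** After [size w] divisions by 3 the order [q] leaves 3, enough for continuity. The constant [C] is
    independent of [f], hence will be uniform in [gamma]. *)
Lemma besov_extension_partials w (q := (3 ^ size w * 3)%N) (s := q%:R + 2^-1 : R) :
  exists2 C : R, 0 <= C & forall A f M F, open A ->
    (forall x, A x -> {for x, continuous f}) -> besov_extension A s f M F ->
    exists g : E -> R, [/\ continuous g, forall x, `|g x| <= C * M &
      forall x, A x -> g x = partials w f x].
Proof.
have q2 : (2 <= q)%N by rewrite (leq_trans _ (leq_pmull _ _)) ?expn_gt0.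
have qs : q%:R <= s < q.+1%:R.
  by rewrite /s lerDl -[ltRHS]natr1 ltrD2l; lra.
have [C C0 CP] := @besov_extension_hoelder R n q s q2 qs.
have [C' C'0 C'P] := @dyadic_hoelder_partials R n q.+1 w (leqW q2).
exists (C' * C) => [|A f M F oA cf Ff]; first by rewrite mulr_ge0.
have [G GH Gf] := CP A f M F oA cf Ff.
have wH := C'P G (C * M) 3%N isT GH.
exists (partials w G); split.
- by apply: dyadic_hoelder_continuous wH => //; exact: leqW.
- by move=> x; rewrite -mulrA; exact: wH.1.
- exact: eq_partials_open.
Qed.

End derivative_bounds.

(** * Extension to the closure and asymptotic expansion *)

Lemma ereal_lt_fin (R : realType) (x : \bar R) : (x < +oo)%E ->
  exists M : R, (x < M%:E)%E.
Proof.
case: x => [r _|//|_]; last by exists 0; exact: ltNyr.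
by exists (r + 1); rewrite lte_fin ltrDl.
Qed.

Theorem corollary1p4 (R : realType) (n : nat) (d_ge2 : (2 <= n.+1)%N)
    (D : set 'rV[R]_n.+1) (D_open : open D)
    (D_bounded : exists r, D `<=` eball 0 r) (D_smooth : smooth_boundary D)
    (N : nat) (Dj : 'I_N -> set 'rV[R]_n.+1) (D_comp : is_components D Dj)
    (h : 'rV[R]_n.+1 -> R) (h_harmonic : harmonic_on setT h)
    (u : R -> 'rV[R]_n.+1 -> R)
    (u_sol : forall gamma, 0 <= gamma -> is_solution D Dj h gamma (u gamma))
    (v : nat -> 'rV[R]_n.+1 -> R) (v_exp : is_expansion D u v) :
  (forall (l : nat) (alpha : 'I_n.+1 -> nat),
    exists g : 'rV[R]_n.+1 -> R,
      {within closure (exterior D), continuous g} /\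
      forall x, exterior D x -> g x = multi_partial alpha (v l) x) /\
  (forall (alpha : 'I_n.+1 -> nat) (K : nat) (U : set 'rV[R]_n.+1),
    open_ball U -> closure D `<=` U ->
    is_big_O (fun gamma => Linfty_norm (U `\` closure D)
      (multi_partial alpha (remainder u v K gamma))) K.+1).
Proof.
have A_open U : open_ball U -> open (U `\` closure D).
  by move=> /open_ball_open oU; rewrite setDE; apply: openI => //; exact: exterior_open.
have v_cont l x : exterior D x -> {for x, continuous (v l)}.
  by move=> Dx; exact: harmonic_on_continuous (expansion_harmonic v_exp l) Dx.
(* At [p = +oo], with [k = q + l] and [s = k + 1/2], the smoothness [s - l] is [q + 1/2] for every
   [l]. *)
have v_besov (q l : nat) U : (0 < q)%N -> open_ball U -> closure D `<=` U ->
    exists M F, besov_extension (U `\` closure D) (q%:R + 2^-1) (v l) M F.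
  move=> q0 bU DU.
  have [/(_ +oo%E (leey _)) + _] : _ /\ _ := expansion_regular v_exp
    (k := (q + l)%N) (l := l) (theta := 1) (s := (q + l)%:R + 2^-1)
    ltac:(by rewrite addn_gt0 q0) ltac:(lra) ltac:(lra) bU DU
    ltac:(by rewrite -ltnS prednK ?addn_gt0 ?q0// -addn1 addnC leq_add2r).
  rewrite /recip addr0 (_ : _ - l%:R = q%:R + 2^-1); last by rewrite natrD; ring.
  by move=> /ereal_lt_fin[M /besov_norm_oo_ltP[F vF]]; exists M, F.
split=> [l alpha|alpha K U bU DU].
  rewrite /multi_partial; set w := flatten _.
  pose q := (3 ^ size w * 3)%N.
  have q0 : (0 < q)%N by rewrite muln_gt0 expn_gt0.
  have [C _ CP] := @besov_extension_partials R n w.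
  have ext U : open_ball U -> closure D `<=` U -> exists2 g : 'rV[R]_n.+1 -> R,
      continuous g & forall x, (U `\` closure D) x -> g x = partials w (v l) x.
    move=> bU DU; have [M [F vF]] := v_besov q l U q0 bU DU.
    have [|g [cg _ gv]] := CP _ _ _ _ (A_open U bU) _ vF; last by exists g.
    by move=> x [_ Dx]; exact: v_cont.
  have [U0 [bU0 DU0 _]] := bounded_closure_ball 0 D_bounded.
  have [g0 cg0 g0v] := ext U0 bU0 DU0.
  (* [g0] is known to agree with the derivative only inside [U0], so it is kept on [closure D] and
     replaced by the derivative elsewhere. *)
  pose g x := if `[< exterior D x >] then partials w (v l) x else g0 x.
  have gE x : exterior D x -> g x = partials w (v l) x.
    by move=> Dx; rewrite /g; case: asboolP.
  exists g; split=> //; apply: continuous_subspaceT => x.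
  have eq_cont (W : set 'rV[R]_n.+1) f : open W -> W x -> continuous f ->
      (forall y, W y -> f y = g y) -> {for x, continuous g}.
    move=> oW Wx cf fg; have fx := fg x Wx.
    have fgx : {near x, f =1 g}.
      by near=> y; apply: fg; near: y; exact: open_nbhs_nbhs (conj oW Wx).
    have := cf x; rewrite /continuous_at fx => cfx.
    exact: cvg_trans (near_eq_cvg fgx) cfx.
  (* On [U0] the function [g] is [g0]. A point outside [U0] is outside [closure D], and a ball
     containing it gives a continuous function equal to [g] near it. *)
  have [Ux|Ux] := pselect (U0 x).
    apply: (eq_cont U0 g0) => //; first exact: open_ball_open.
    by move=> y Uy; rewrite /g; case: asboolP => // Dy; rewrite g0v.
  have [U [bU DU xU]] := bounded_closure_ball x D_bounded.
  have [g1 cg1 g1v] := ext U bU DU.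
  apply: (eq_cont (U `\` closure D) g1) => //; first exact: A_open.
    by split=> // /DU0.
  by move=> y [Uy Dy]; rewrite g1v// gE.
rewrite /multi_partial; set w := flatten _.
pose q := (3 ^ size w * 3)%N.
have q0 : (0 < q)%N by rewrite muln_gt0 expn_gt0.
have [C C0 CP] := @besov_extension_partials R n w.
have [M [F vF]] := v_besov q K.+1 U q0 bU DU.
(* With [s = q + K + 2 + 1/2], the smoothness [s - 1 - (K + 1)] is again [q + 1/2], as for [v K.+1],
   so the two extensions can be added. The little-o is used with [eps = 1]. *)
have [_ /(_ +oo%E (ltry _) 1 ltr01)] : _ /\ _ := expansion_remainder v_exp
    (k := (q + K.+2)%N) (K := K.+1) (theta := 1) (s := (q + K.+2)%:R + 2^-1)
    ltac:(by rewrite addn_gt0 q0) ltac:(lra) ltac:(lra) bU DU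
    ltac:(by rewrite addnS /= leq_addl).
rewrite /recip addr0 (_ : _ - K.+1%:R = q%:R + 2^-1); last first.
  by rewrite natrD -[K.+2%:R]natr1; ring.
(* The remainder of order [K + 1] has norm at most [gamma^(K+1)], and the strict bound needed to
   obtain an extension is [2 gamma^(K+1)]; the term of [v K.+1] contributes [M gamma^(K+1)]. *)
move=> rem; exists (C * (2 + M)).
near=> gamma.
have gamma0 : 0 < gamma by near: gamma; exact: nbhs_right_gt.
have gK : 0 < gamma ^+ K.+1 by rewrite exprn_gt0.
have [|G remG] := @besov_norm_oo_ltP R n (U `\` closure D) (q%:R + 2^-1)
    (remainder u v K.+1 gamma) (2 * gamma ^+ K.+1).
  have : (besov_norm (U `\` closure D) (q%:R + 2^-1) +oo%E
    (remainder u v K.+1 gamma) <= (1 * gamma ^+ K.+1)%:E)%E by near: gamma.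
  by move=> /le_lt_trans; apply; rewrite lte_fin; lra.
have := besov_extensionD (ltW gK) remG vF.
rewrite (_ : (fun x => remainder _ _ _ _ _ + _) = remainder u v K gamma); last first.
  by apply/funext => x; rewrite /remainder [in LHS]big_ord_recr /=; ring.
move=> /(CP _ _ _ _ (A_open U bU))[x [Ux Dx]|g [_ gB gE]].
  have uc : {for x, continuous (u gamma)}.
    have := solution_harmonic (u_sol gamma (ltW gamma0)).
    by move=> /harmonic_on_continuous; apply=> -[].
  have vc : {for x, continuous (fun y => \sum_(l < K.+1) gamma ^+ l * v l y)}.
    apply: (@cvg_big _ _ _ _ _ (@add_continuous R) _ (nbhs x) _
      (fun l : 'I_K.+1 => fun y => gamma ^+ l * v l y)) => l _.
    by apply: cvgMl_tmp; exact: v_cont.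
  exact: continuousB uc vc.
apply/Lp_norm_oo_le; apply: nearW => x.
rewrite indicE; case: (boolP (x \in _)) => [|_]; last first.
  (* Off the set the function is 0, and the bound is nonnegative since it dominates [|g x|]. *)
  rewrite mul0r normr0 (le_trans (normr_ge0 (g x)))// (le_trans (gB x))//.
  rewrite le_eqVlt; apply/orP; left; apply/eqP; ring.
rewrite inE => Ax; rewrite mul1r -gE// (le_trans (gB x))//.
rewrite le_eqVlt; apply/orP; left; apply/eqP; ring.
Unshelve. all: by end_near. Qed.
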